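(* Given $L\in\mathcal{L}$ and $m\ge2$, let $A_1,\ldots,A_m$ be non-negative matrices that define operators on $L$. For $t\in[1,m]$ and $i=1,\ldots,m$, put $$P_i=A_i^{(t)}A_{i+1}^{(t)}\cdots A_m^{(t)}A_1^{(t)}A_2^{(t)}\cdots A_{i-1}^{(t)}.$$ Then $$\rho(A_1\circ A_2\circ\cdots\circ A_m)\le\rho(A_1\circ A_2\circ\cdots\circ A_m)^{1-\frac tm}\,\rho\left(P_1^{(\frac1t)}\circ\cdots\circ P_m^{(\frac1t)}\right)^{\frac{t}{m^2}}$$ $$\le\rho(A_1\circ A_2\circ\cdots\circ A_m)^{1-\frac tm}\,\rho(A_1^{(t)}\cdots A_m^{(t)})^{\frac1m}$$ $$\le\rho(A_1\circ A_2\circ\cdots\circ A_m)^{1-\frac tm}\,\rho((A_1\cdots A_m)^{(t)})^{\frac1m}\le\rho(A_1A_2\cdots A_m).$$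
   Context: Let $R$ be either $\{1,\ldots,n\}$ for some $n\in\mathbb{N}$ or $\mathbb{N}$, and let $S(R)$ be the vector lattice of all complex sequences $(x_i)_{i\in R}$. A Banach space $L\subseteq S(R)$ is a Banach sequence space if $x\in S(R)$, $y\in L$ and $|x|\le|y|$ (coordinatewise) imply $x\in L$ and $\|x\|_L\le\|y\|_L$. $\mathcal{L}$ is the collection of all Banach sequence spaces $L$ such that $e_i=\chi_{\{i\}}\in L$ and $\|e_i\|_L=1$ for all $i\in R$. A matrix $A=[a_{ij}]_{i,j\in R}$ (possibly infinite) is non-negative if $a_{ij}\ge0$ for all $i,j\in R$. A non-negative matrix $A$ defines an operator on $L$ if $Ax\in L$ for all $x\in L$, where $(Ax)_i=\sum_{j\in R}a_{ij}x_j$; this operator is automatically bounded, and $A$ is identified with it. $\rho(A)$ is the spectral radius; juxtaposition is the ordinary matrix product. For non-negative matrices, $A\circ B=[a_{ij}b_{ij}]_{i,j\in R}$ is the Hadamard product and $A^{(t)}=[a_{ij}^t]_{i,j\in R}$, $t\ge0$, is the Hadamard power. The convention $0^0=1$ is used. For $L\in\mathcal{L}$, all matrices occurring in the claim as arguments of $\rho$ define operators on $L$. *)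

(* Defs.v *)
From HB Require Import structures.
From mathcomp Require Import all_boot all_order all_algebra.
From mathcomp Require Export complex.
From mathcomp Require Import all_classical all_reals all_analysis.

Set Implicit Arguments.
Unset Strict Implicit.
Unset Printing Implicit Defensive.

Import Order.TTheory GRing.Theory Num.Theory.
Import numFieldNormedType.Exports.

Local Open Scope classical_set_scope.
Local Open Scope ring_scope.
Local Open Scope complex_scope.

(* [initial_segment n] stands for {1, ..., n + 1}, so that it is never empty;
   indices are shifted to start at 0. *)
Variant index_set := initial_segment of nat | all_naturals.

Definition idx (N : index_set) : choiceType :=
  match N with
  | initial_segment n => 'I_n.+1
  | all_naturals => nat
  end.

Section IndexedSums.
Variable K : numFieldType.

Definition summable_on (N : index_set) : (idx N -> K) -> Prop :=
  match N with
  | initial_segment _ => fun=> True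
  | all_naturals => fun f => cvgn (series f)
  end.

Definition sum_on (N : index_set) : (idx N -> K) -> K :=
  match N with
  | initial_segment n => fun f => \sum_(j < n.+1) f j
  | all_naturals => fun f => limn (series f)
  end.

End IndexedSums.

Arguments summable_on {K N} f.
Arguments sum_on {K N} f.

(* The inclusion of L in the space of all complex sequences is the injective
   linear map [bss_coord], so an element of L is determined by its coordinates.
   The norm of a normed module over R[i] takes values in R[i], where
   x <= y means that y - x is a non-negative real number. *)
Record banach_sequence_space (R : realType) (N : index_set) := {
  bss_space :> completeNormedModType R[i];
  bss_coord : bss_space -> idx N -> R[i];
  coord_linear : forall (a : R[i]) (x y : bss_space) i,
    bss_coord (a *: x + y) i = a * bss_coord x i + bss_coord y i;
  coord_inj : injective bss_coord;
  bss_ideal : forall (x : idx N -> R[i]) (y : bss_space),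
    (forall i, `|x i| <= `|bss_coord y i|) ->
    exists2 z : bss_space, bss_coord z = x & `|z| <= `|y|
}.

Arguments bss_coord {R N} b x i.

(* The class of spaces containing all e_i with norm one. *)
Definition unit_normalized (R : realType) (N : index_set)
    (L : banach_sequence_space R N) : Prop :=
  forall i : idx N,
    exists2 e : L, bss_coord L e = (fun j => (j == i)%:R) & `|e| = 1.

Section Matrices.
Variables (R : realType) (N : index_set).

Definition mx := idx N -> idx N -> R.

Implicit Types A B : mx.

Definition mx_nonneg A : Prop := forall i j, 0 <= A i j.

Definition mx_one : mx := fun i j => (i == j)%:R.

Definition mx_mul A B : mx := fun i k => sum_on (fun j => A i j * B j k).

Definition hadamard m (A : 'I_m -> mx) : mx := fun i j => \prod_(k < m) A k i j.

(* [powR] satisfies 0 `^ 0 = 1. *)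
Definition hadamard_pow A (t : R) : mx := fun i j => A i j `^ t.

Definition mx_app A (x : idx N -> R[i]) : idx N -> R[i] :=
  fun i => sum_on (fun j => (A i j)%:C * x j).

Definition defines_operator (L : banach_sequence_space R N) A : Prop :=
  forall x : L,
    (forall i, summable_on (fun j => (A i j)%:C * bss_coord L x j)) /\
    exists y : L, bss_coord L y = mx_app A (bss_coord L x).

(* A x as an element of L; it is 0 if that sequence is not in L. *)
Definition mx_operator (L : banach_sequence_space R N) A : L -> L :=
  fun x => xget 0 [set y : L | bss_coord L y = mx_app A (bss_coord L x)].

End Matrices.

Arguments mx_operator {R N} L A x.

Section Spectrum.
Variables (R : realType) (V : completeNormedModType R[i]).

(* Continuity of the linear map S is boundedness, so S is an inverse of l - T
   in the algebra of bounded operators on V. *)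
Definition spectrum (T : V -> V) : set R[i] :=
  [set l | ~ exists S : {linear V -> V},
     [/\ continuous S,
         forall x, S (l *: x - T x) = x &
         forall x, l *: S x - T (S x) = x]].

Definition spectral_radius (T : V -> V) : R :=
  sup [set complex.Re `|l| | l in spectrum T].

End Spectrum.

Definition rho (R : realType) (N : index_set) (L : banach_sequence_space R N)
    (A : mx R N) : R :=
  spectral_radius (mx_operator L A).

Definition mx_prod (R : realType) (N : index_set) (m : nat)
    (A : 'I_m -> mx R N) : mx R N :=
  \big[@mx_mul R N/@mx_one R N]_(k < m) A k.

(* A_i ... A_m A_1 ... A_(i-1). *)
Definition mx_cyclic_prod (R : realType) (N : index_set) (m : nat)
    (A : 'I_m -> mx R N) (i : 'I_m) : mx R N :=
  \big[@mx_mul R N/@mx_one R N]_(k <- rot i (enum 'I_m)) A k.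

(* Main.v *)
(* For a positive operator A the spectral radius rho(A) is controlled by the
   powers of A alone: if |A^k| <= C mu^k for all k then rho(A) <= mu by the
   Neumann series, and if mu > rho(A) then the resolvent S of A at mu is
   positive, so that A^k x <= mu^(k+1) S x for x >= 0 and |A^k| <= C mu^k.
   Hence rho is monotone, rho(AB) = rho(BA), rho(A)^m <= rho(A^m), and, by
   Hoelder's inequality,
     rho(B_1^(a) o ... o B_n^(a)) <= max_i rho(B_i)^(n a)   if n a >= 1,
   where n a > 1 is allowed because the norm of a matrix bounds its entries.
   With a = 1/t this bounds rho(P_1^(1/t) o ... o P_m^(1/t)) from above by
   rho(A_1^(t) ... A_m^(t))^(m/t); and the matrix itself dominates
   (A_1 o ... o A_m)^m, the l-th factor of which is read as
   A_l o A_(l+1) o ... o A_(l-1). *)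
From HB Require Import structures.
Require Import Defs.
From mathcomp Require Import all_boot all_order all_algebra.
From mathcomp Require Import all_classical all_reals all_analysis.
From mathcomp Require Import ring lra.

Set Implicit Arguments.
Unset Strict Implicit.
Unset Printing Implicit Defensive.

Import Order.TTheory GRing.Theory Num.Theory.
Import numFieldNormedType.Exports.

Local Open Scope ring_scope.

Local Open Scope classical_set_scope.
Local Open Scope complex_scope.

(** * Sums over the index set and Hoelder's inequality *)

(** The obstacle is that rho is defined through the spectrum in the algebra of bounded operators,
    while the estimates concern entries of powers. Growth up to a constant is enough to connect the
    two, so bounds are tested on the positive cone, where all sums are series of non-negative reals.
    The delicate point is positivity of the resolvent for mu between rho(A) and the norm of A. A
    Neumann series there would presuppose the growth bound that is being proved, so positivity is
    carried down from large mu by resolvent identities and closedness of the cone. The e_i need not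
    span a dense subspace of L, so operator identities cannot be checked on them alone; (AB)x =
    A(Bx) comes from Tonelli on positive vectors. Hoelder with n a > 1 rests on normalisation: once
    all numbers lie in [0, 1], raising the exponent from 1/n to a only decreases their product, and
    the inequality of arithmetic and geometric means finishes. *)

Definition indices (N : index_set) (n : nat) : seq (idx N) :=
  match N return seq (idx N) with
  | initial_segment p => enum 'I_p.+1
  | all_naturals => iota 0 n
  end.

(** [sum_on] returns a default limit when the series diverges, so convergence and value are recorded
    together. For a finite index set [indices] ignores n and the sequence is constant, which treats
    both kinds of index set at once. *)
Definition has_sum (K : numFieldType) (N : index_set) (f : idx N -> K) (s : K) :=
  (\sum_(j <- indices N n) f j) @[n --> \oo] --> s.

Lemma uniq_indices N n : uniq (indices N n).
Proof. by case: N => [p|] /=; [exact: enum_uniq | exact: iota_uniq]. Qed.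

Lemma near_indices N (j : idx N) : \forall n \near \oo, j \in indices N n.
Proof.
case: N j => [p|] j /=; first by apply: nearW => n; rewrite mem_enum.
by exists j.+1 => // n /= jn; rewrite mem_iota.
Qed.

Lemma sum_indices_homo (R : numDomainType) N (f : idx N -> R) : (forall j, 0 <= f j) ->
  {homo (fun n => \sum_(j <- indices N n) f j) : m n / (m <= n)%N >-> m <= n}.
Proof.
move=> f0 m n mn; case: N f f0 => [p|] f f0 //=.
rewrite -(subnK mn) addnC iotaD big_cat /= lerDl.
by apply: sumr_ge0.
Qed.

Section HasSum.
Variables (K : numFieldType) (N : index_set).
Implicit Types (f g : idx N -> K) (s t a : K).

Lemma has_sum_unique f s t : has_sum f s -> has_sum f t -> s = t.
Proof. by apply: cvg_unique; exact: norm_hausdorff. Qed.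

Lemma has_sum_sum_on f s : has_sum f s -> summable_on f /\ sum_on f = s.
Proof.
rewrite /has_sum; case: N f => [p|] f /=.
- move=> H; split => //.
  apply: (cvg_unique (@norm_hausdorff _ K) _ H).
  by rewrite big_enum; exact: cvg_cst.
- move=> H; have E : series f = (fun n => \sum_(j <- iota 0 n) f j).
    by apply/funext => n; rewrite /series /= /index_iota subn0.
  rewrite E; split; first by apply/cvg_ex; exists s.
  by apply: cvg_lim H; exact: norm_hausdorff.
Qed.

Lemma summable_has_sum f : summable_on f -> has_sum f (sum_on f).
Proof.
rewrite /has_sum; case: N f => [p|] f /=.
- by move=> _; rewrite big_enum /=; exact: cvg_cst.
- have -> : series f = (fun n => \sum_(j <- iota 0 n) f j).
    by apply/funext => n; rewrite /series /= /index_iota subn0.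
  by [].
Qed.

Lemma has_sum_lin a f g s t : has_sum f s -> has_sum g t ->
  has_sum (fun j => a * f j + g j) (a * s + t).
Proof.
move=> fs gt; rewrite /has_sum.
under eq_fun do rewrite big_split /= -mulr_sumr.
by apply: cvgD gt; apply: cvgMr.
Qed.

Lemma has_sum0 : has_sum (fun _ : idx N => 0 : K) 0.
Proof. by rewrite /has_sum; under eq_fun do rewrite big1 //; exact: cvg_cst. Qed.

Lemma has_sumZ a f s : has_sum f s -> has_sum (fun j => a * f j) (a * s).
Proof.
move=> fs; have := has_sum_lin (a := a) fs has_sum0.
by rewrite addr0; under eq_fun do rewrite addr0.
Qed.

Lemma has_sumD f g s t : has_sum f s -> has_sum g t ->
  has_sum (fun j => f j + g j) (s + t).
Proof.
move=> fs gt; have := has_sum_lin (a := 1) fs gt.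
by rewrite mul1r; under eq_fun do rewrite mul1r.
Qed.

Lemma has_sum_bigsum (I : Type) (r : seq I) (F : I -> idx N -> K) (S : I -> K) :
  (forall i, has_sum (F i) (S i)) ->
  has_sum (fun j => \sum_(i <- r) F i j) (\sum_(i <- r) S i).
Proof.
move=> FS; elim: r => [|i r IH].
- by rewrite big_nil; under eq_fun do rewrite big_nil; exact: has_sum0.
- by rewrite big_cons; under eq_fun do rewrite big_cons; exact: has_sumD.
Qed.

Lemma has_sum_delta (i : idx N) f : has_sum (fun j => (i == j)%:R * f j) (f i).
Proof.
apply: cvg_near_cst; near=> n.
have iin : i \in indices N n by near: n; exact: near_indices.
rewrite (bigD1_seq i) //= ?uniq_indices // eqxx mul1r big1 ?addr0 //.
by move=> j /negPf; rewrite eq_sym => ->; rewrite mul0r.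
Unshelve. all: by end_near. Qed.

End HasSum.

Arguments has_sum_delta {K N} i f.

Section RealSums.
Variables (R : realType) (N : index_set).
Implicit Types (f g : idx N -> R) (s t : R).

Lemma ler_has_sum f g s t : (forall j, f j <= g j) ->
  has_sum f s -> has_sum g t -> s <= t.
Proof.
move=> fg fs gt; apply: (ler_cvg_to fs gt).
by apply: nearW => n; apply: ler_sum.
Qed.

Lemma has_sum_ge0 f s : (forall j, 0 <= f j) -> has_sum f s -> 0 <= s.
Proof. by move=> f0; apply: ler_has_sum f0 _; exact: has_sum0. Qed.

Lemma partial_sum_le f s n : (forall j, 0 <= f j) -> has_sum f s ->
  \sum_(j <- indices N n) f j <= s.
Proof.
move=> f0 fs; apply: (ler_cvg_to (cvg_cst _) fs).
by exists n => // k /= nk; apply: sum_indices_homo.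
Qed.

Lemma has_sum_bounded f s :
  (forall j, 0 <= f j) -> (forall n, \sum_(j <- indices N n) f j <= s) ->
  exists2 t, has_sum f t & t <= s.
Proof.
move=> f0 fs.
have c : cvgn (fun n => \sum_(j <- indices N n) f j).
  apply: nondecreasing_is_cvgn; first exact: sum_indices_homo.
  by exists s => _ [n _ <-].
exists (limn (fun n => \sum_(j <- indices N n) f j)) => //.
by apply: (ler_cvg_to c (cvg_cst _)); apply: nearW.
Qed.

Lemma has_sum_dom f g t : (forall j, 0 <= f j) -> (forall j, f j <= g j) ->
  has_sum g t -> exists2 s, has_sum f s & s <= t.
Proof.
move=> f0 fg gt; apply: has_sum_bounded => // n.
apply: le_trans (partial_sum_le n _ gt); first exact: ler_sum.
by move=> j; exact: le_trans (fg j).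
Qed.

Lemma term_le_sum f s i : (forall j, 0 <= f j) -> has_sum f s -> f i <= s.
Proof.
move=> f0 fs; have [n _ /(_ n (leqnn n)) ni] := near_indices i.
apply: le_trans (partial_sum_le n f0 fs).
by rewrite (bigD1_seq i) ?uniq_indices //= lerDl sumr_ge0.
Qed.

Lemma has_sum_eq0 f : (forall j, 0 <= f j) -> has_sum f 0 -> forall j, f j = 0.
Proof.
move=> f0 fs j; apply/eqP; rewrite eq_le f0 andbT; exact: term_le_sum fs.
Qed.

(** Tonelli for non-negative double series. Finitely many columns are dominated row by row by [a],
    so the column sums total at most s; the symmetric argument with finitely many rows gives the
    reverse bound. *)
Lemma has_sum_exchange (F : idx N -> idx N -> R) (a : idx N -> R) (s : R) :
  (forall i j, 0 <= F i j) -> (forall i, has_sum (F i) (a i)) -> has_sum a s ->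
  exists2 b, (forall j, has_sum (fun i => F i j) (b j)) & has_sum b s.
Proof.
move=> F0 Fa as_.
have a0 i : 0 <= a i by apply: has_sum_ge0 (Fa i).
have /choice[b Fb] : forall j, exists b, has_sum (fun i => F i j) b.
  move=> j; have [] := @has_sum_dom (F ^~ j) a s _ _ as_; last by move=> b Hb _; exists b.
  - by [].
  - by move=> i; exact: term_le_sum (Fa i).
exists b => //.
have b0 j : 0 <= b j by apply: has_sum_ge0 (Fb j).
have [t bt ts] : exists2 t, has_sum b t & t <= s.
  apply: has_sum_bounded => // n.
  apply: (ler_has_sum _ (has_sum_bigsum (r := indices N n) Fb) as_) => i.
  exact: partial_sum_le.
suff -> : s = t by [].
apply/eqP; rewrite eq_le ts andbT.
apply: (ler_cvg_to as_ (cvg_cst _)); apply: nearW => n.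
apply: (ler_has_sum _ (has_sum_bigsum (r := indices N n) Fa) bt) => j.
exact: partial_sum_le.
Qed.

Lemma has_sumC f s : has_sum f s -> has_sum (fun j => (f j)%:C) s%:C.
Proof.
move=> /cvgrPdist_lt fs; apply/cvgrPdist_lt => e.
case: e => [e e']; rewrite ltcE /= => /andP[/eqP -> e0].
apply: filterS (fs _ e0) => n.
rewrite -(rmorph_sum (real_complex R)) -rmorphB /= normc_def /= expr0n addr0 sqrtr_sqr.
by rewrite ltcR.
Qed.

End RealSums.

Section Holder.
Variable R : realType.

Lemma prod_powR (I : Type) (r : seq I) (u : I -> R) (a : R) : (forall i, 0 <= u i) ->
  \prod_(i <- r) u i `^ a = (\prod_(i <- r) u i) `^ a.
Proof.
move=> u0; elim: r => [|i r IH]; first by rewrite !big_nil powR1.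
by rewrite !big_cons IH powRM ?prodr_ge0.
Qed.

Variables (n : nat) (a : R).
Hypotheses (n_gt0 : (0 < n)%N) (na_ge1 : 1 <= n%:R * a).

Lemma weight_gt0 : 0 < a.
Proof.
have : 0 < n%:R * a by exact: lt_le_trans na_ge1.
by rewrite pmulr_rgt0 // ltr0n.
Qed.

(** The product p lies in [0, 1] and a >= 1/n, so p^a <= p^(1/n), the geometric mean. *)
Lemma prod_powR_le_mean (u : 'I_n -> R) : (forall i, 0 <= u i <= 1) ->
  \prod_(i < n) u i `^ a <= n%:R^-1 * \sum_(i < n) u i.
Proof.
move=> u01; have u0 i : 0 <= u i by have /andP[] := u01 i.
have nR : 0 < n%:R :> R by rewrite ltr0n.
rewrite prod_powR //; set p := \prod_(i < n) _; set mu := (_ * _).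
have mu0 : 0 <= mu by rewrite mulr_ge0 ?invr_ge0 ?ler0n // sumr_ge0.
have p0 : 0 <= p by apply: prodr_ge0.
have p1 : p <= 1 by apply: prodr_ile1 => i _; exact: u01.
have pmu : p <= mu ^+ n.
  have [] := @leif_AGM _ 'I_n predT u (fun i _ => u0 i).
  by rewrite cardT size_enum_ord [_ / _]mulrC.
have an : n%:R^-1 <= a by rewrite -[_^-1]mulr1 ler_pdivrMl.
apply: (@le_trans _ _ (p `^ n%:R^-1)).
  (* At p = 0 both powers vanish because both exponents are positive, so the convention 0^0 = 1 does
     not interfere. *)
  have [->|pn0] := eqVneq p 0.
    by rewrite !powR0 ?gt_eqF ?weight_gt0 ?invr_gt0.
  by apply: ger_powR => //; rewrite lt_neqAle eq_sym pn0 p0.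
have -> : mu = (mu ^+ n) `^ n%:R^-1.
  by rewrite -powR_mulrn // -powRrM divff ?gt_eqF // powRr1.
by apply: ge0_ler_powR; rewrite ?nnegrE ?invr_ge0 ?exprn_ge0 // ltW.
Qed.

(** Dividing each family by its sum puts its terms in [0, 1], where the mean inequality applies; the
    means of the normalised families sum to 1. *)
Lemma has_sum_holder (N : index_set) (c : 'I_n -> idx N -> R) (S : 'I_n -> R) :
  (forall i j, 0 <= c i j) -> (forall i, has_sum (c i) (S i)) ->
  exists2 s, has_sum (fun j => \prod_(i < n) c i j `^ a) s &
    s <= \prod_(i < n) S i `^ a.
Proof.
move=> c0 cS; have S0 i : 0 <= S i by apply: has_sum_ge0 (cS i).
(* A family with sum 0 cannot be normalised, but all its terms vanish and so does every product. *)
have [/existsP[i0 /eqP Si0]|] := boolP [exists i, S i == 0].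
  exists 0; last by apply: prodr_ge0 => i _; exact: powR_ge0.
  have -> : (fun j => \prod_(i < n) c i j `^ a) = fun=> 0.
    apply/funext => j; rewrite (bigD1 i0) //=.
    have := cS i0; rewrite Si0 => /(has_sum_eq0 (c0 i0)) ->.
    by rewrite powR0 ?mul0r // gt_eqF // weight_gt0.
  exact: has_sum0.
rewrite negb_exists => /forallP Sn0.
have Sp i : 0 < S i by rewrite lt_neqAle eq_sym Sn0 S0.
have ul i j : 0 <= c i j / S i <= 1.
  rewrite divr_ge0 //= ler_pdivrMr // mul1r.
  exact: term_le_sum (cS i).
set M := \prod_(i < n) S i `^ a.
have M0 : 0 <= M by apply: prodr_ge0 => i _; exact: powR_ge0.
have H : has_sum (fun j => M * (n%:R^-1 * \sum_(i < n) c i j / S i)) (M * 1).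
  apply: has_sumZ.
  have E : 1 = n%:R^-1 * \sum_(i < n) 1 :> R.
    by rewrite sumr_const card_ord mulVf // pnatr_eq0 -lt0n.
  rewrite [X in has_sum _ X]E; apply: has_sumZ; apply: has_sum_bigsum => i.
  have := has_sumZ (a := (S i)^-1) (cS i); rewrite mulVf ?gt_eqF //.
  by under eq_fun do rewrite mulrC.
rewrite mulr1 in H; apply: has_sum_dom H => j.
  by apply: prodr_ge0 => i _; exact: powR_ge0.
apply: le_trans (ler_wpM2l M0 (prod_powR_le_mean (ul ^~ j))).
rewrite -big_split /= le_eqVlt; apply/orP; left; apply/eqP/eq_bigr => i _.
rewrite -powRM ?divr_ge0 //; congr (_ `^ _).
by rewrite mulrC divfK // gt_eqF.
Qed.

End Holder.

(** * Banach sequence spaces *)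

Section RealNorm.
Variables (R : realType) (V : completeNormedModType R[i]).
Implicit Types (x y : V) (u : nat -> V).

(** The order of [R[i]] is only partial; passing to the real part loses nothing on norms and makes
    order arguments in [R] available. *)
Definition real_norm x : R := complex.Re `|x|.

Lemma real_normE x : `|x| = (real_norm x)%:C.
Proof. by rewrite /real_norm RRe_real // normr_real. Qed.

Lemma real_norm_ge0 x : 0 <= real_norm x.
Proof. by rewrite -ler0c -real_normE. Qed.

Lemma real_norm0 : real_norm 0 = 0.
Proof. by rewrite /real_norm normr0. Qed.

Lemma real_norm_eq0 x : real_norm x = 0 -> x = 0.
Proof. by move=> x0; apply/eqP; rewrite -normr_eq0 real_normE x0. Qed.

Lemma ler_real_normD x y : real_norm (x + y) <= real_norm x + real_norm y.
Proof. by rewrite -lecR rmorphD /= -!real_normE ler_normD. Qed.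

Lemma real_normN x : real_norm (- x) = real_norm x.
Proof. by rewrite /real_norm normrN. Qed.

Lemma real_normZ (a : R[i]) x : real_norm (a *: x) = complex.Re `|a| * real_norm x.
Proof.
apply: complexI; rewrite rmorphM /= -!real_normE normrZ; congr (_ * _).
Qed.

Lemma Re_norm_real (r : R) : complex.Re `|r%:C| = `|r|.
Proof. by rewrite normc_def /= expr0n addr0 sqrtr_sqr. Qed.

Lemma real_normZr (r : R) x : real_norm (r%:C *: x) = `|r| * real_norm x.
Proof. by rewrite real_normZ Re_norm_real. Qed.

Lemma cvg_real_normP u x : u @ \oo --> x <->
  forall e : R, 0 < e -> \forall n \near \oo, real_norm (x - u n) < e.
Proof.
split=> [/cvgrPdist_lt ux e e0|ux].
- have := ux e%:C; rewrite ltcR => /(_ e0); apply: filterS => n.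
  by rewrite real_normE ltcR.
- apply/cvgrPdist_lt => -[e e']; rewrite ltcE /= => /andP[/eqP -> e0].
  by apply: filterS (ux _ e0) => n; rewrite real_normE ltcR.
Qed.

Lemma real_norm_lim u x (M : R) : u @ \oo --> x ->
  (forall n, real_norm (u n) <= M) -> real_norm x <= M.
Proof.
move=> /cvg_real_normP ux uM; apply/ler_addgt0Pr => e e0.
have [n _ /(_ n (leqnn n)) H] := ux _ e0.
rewrite -(subrK (u n) x); apply: le_trans (ler_real_normD _ _) _.
by rewrite addrC lerD // ltW.
Qed.

Lemma cvg_series_geometric u (C q : R) : 0 <= q < 1 ->
  (forall n, real_norm (u n) <= C * q ^+ n) -> cvgn (series u).
Proof.
move=> /andP[q0 q1] uC; apply: cauchy_cvg; apply/cauchy_seriesP => -[e e'].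
rewrite ltcE /= => /andP[/eqP -> e0].
have /cauchy_cvgP/cauchy_seriesP/(_ e e0) : cvgn (series (geometric C q)).
  by apply: is_cvg_geometric_series; rewrite ger0_norm.
apply: filterS => -[m n] /= H.
rewrite real_normE ltcR; apply: le_lt_trans (H).
apply: le_trans (ler_norm _).
elim/big_ind2 : _ => [|x1 x2 y1 y2 h1 h2|k _]; first by rewrite real_norm0.
  by apply: le_trans (ler_real_normD _ _) _; exact: lerD.
exact: uC.
Qed.

End RealNorm.

Section SequenceSpace.
Variables (R : realType) (N : index_set) (L : banach_sequence_space R N).
Implicit Types (x y : L) (f g : idx N -> R).
Local Notation coord := (bss_coord L).
Local Notation nrm := (@real_norm R L).

Lemma bss_coordD x y i : coord (x + y) i = coord x i + coord y i.
Proof. by have := coord_linear 1 x y i; rewrite scale1r mul1r. Qed.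

Lemma bss_coord0 i : coord 0 i = 0.
Proof. by apply: (addrI (coord 0 i)); rewrite -bss_coordD !addr0. Qed.

Lemma bss_coordZ a x i : coord (a *: x) i = a * coord x i.
Proof. by rewrite -[a *: x]addr0 coord_linear bss_coord0 addr0. Qed.

Lemma bss_coordN x i : coord (- x) i = - coord x i.
Proof. by rewrite -scaleN1r bss_coordZ mulN1r. Qed.

Lemma bss_coord_sum (I : Type) (r : seq I) (F : I -> L) i :
  coord (\sum_(k <- r) F k) i = \sum_(k <- r) coord (F k) i.
Proof.
elim: r => [|k r IH]; first by rewrite !big_nil bss_coord0.
by rewrite !big_cons bss_coordD IH.
Qed.

Definition represents x f := coord x = fun i => (f i)%:C.

Lemma coord_dom x (h : idx N -> R[i]) : (forall i, `|h i| <= `|coord x i|) ->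
  exists2 z, coord z = h & nrm z <= nrm x.
Proof.
move=> /(@bss_ideal _ _ L)[z zh zx]; exists z => //.
by rewrite -lecR -!real_normE.
Qed.

Lemma represents_dom y f g : (forall i, 0 <= f i) -> (forall i, f i <= g i) ->
  represents y g -> exists2 x, represents x f & nrm x <= nrm y.
Proof.
move=> f0 fg yg; apply: coord_dom => i; rewrite yg !normc_def /= !expr0n !addr0.
by rewrite lecR !sqrtr_sqr !ger0_norm // (le_trans _ (fg i)).
Qed.

Lemma represents_inj x y f : represents x f -> represents y f -> x = y.
Proof. by move=> xf yf; apply: (@coord_inj _ _ L); rewrite xf yf. Qed.

Lemma represents_le x y f g : (forall i, 0 <= f i) -> (forall i, f i <= g i) ->
  represents x f -> represents y g -> nrm x <= nrm y.
Proof.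
move=> f0 fg xf yg; have [z zf zy] := represents_dom f0 fg yg.
by rewrite (represents_inj xf zf).
Qed.

Lemma represents_lin (a : R) x y f g : represents x f -> represents y g ->
  represents (a%:C *: x + y) (fun i => a * f i + g i).
Proof.
move=> xf yg; apply/funext => i.
by rewrite coord_linear xf yg rmorphD rmorphM.
Qed.

Lemma represents0 : represents 0 (fun=> 0).
Proof. by apply/funext => i; rewrite bss_coord0. Qed.

Hypothesis hL : unit_normalized L.

Lemma represents_unit i : exists2 e : L, represents e (fun j => (j == i)%:R) & nrm e = 1.
Proof.
have [e ei e1] := hL i; exists e; last by rewrite /real_norm e1.
by rewrite /represents ei; apply/funext => j; rewrite rmorph_nat.
Qed.

(** The sequence |x_i| e_i is dominated by x, and e_i has norm one. Hence the coordinates are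
    continuous, and limits in L can be read coordinatewise. *)
Lemma coord_le_norm x i : `|coord x i| <= `|x|.
Proof.
have [e ei e1] := hL i.
have [z zE zx] : exists2 z, coord z = (fun j => `|coord x i| * (j == i)%:R) & nrm z <= nrm x.
  apply: coord_dom => j; have [->|_] := eqVneq j i.
    by rewrite mulr1 normr_id.
  by rewrite mulr0 normr0.
have -> : `|coord x i| = `|z|; last by rewrite !real_normE lecR.
have -> : z = `|coord x i| *: e.
  by apply: (@coord_inj _ _ L); rewrite zE; apply/funext => j; rewrite bss_coordZ ei.
by rewrite normrZ e1 mulr1 normr_id.
Qed.

Lemma represents_le_norm x f i : represents x f -> f i <= nrm x.
Proof.
move=> xf; rewrite -lecR -real_normE; apply: le_trans (coord_le_norm x i).
by rewrite xf normc_def /= expr0n addr0 sqrtr_sqr lecR ler_norm.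
Qed.

End SequenceSpace.

(** * Bounded positive matrices *)

Section PositiveBound.
Variables (R : realType) (N : index_set) (L : banach_sequence_space R N).
Hypothesis hL : unit_normalized L.
Implicit Types (A B C : mx R N) (x y : L) (f g : idx N -> R) (a b c : R).
Local Notation nrm := (@real_norm R L).

(* Only positive vectors are tested: every x is a combination of four positive
   vectors of norm at most |x|, so this bounds the operator norm by 4 c, and the
   factor 4 is irrelevant for power growth. *)
Definition positive_bound A c := mx_nonneg A /\
  forall x f, (forall i, 0 <= f i) -> represents x f ->
  exists y g, [/\ forall i, has_sum (fun j => A i j * f j) (g i),
    represents y g & nrm y <= c * nrm x].

Definition mx_le A B := forall i j, A i j <= B i j.

Lemma has_sum_ge0_mx A f g : mx_nonneg A -> (forall i, 0 <= f i) ->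
  (forall i, has_sum (fun j => A i j * f j) (g i)) -> forall i, 0 <= g i.
Proof. by move=> A0 f0 Af i; apply: has_sum_ge0 (Af i) => j; rewrite mulr_ge0. Qed.

(** For x >= 0 the rows of A x converge by comparison with those of B x, and the ideal property then
    places A x in L with no larger norm. *)
Lemma positive_bound_mono A B a b : mx_nonneg A -> mx_le A B -> a <= b ->
  positive_bound B a -> positive_bound A b.
Proof.
move=> A0 AB ab [B0 Bb]; split => // x f f0 xf.
have [y [g [Bg yg yx]]] := Bb x f f0 xf.
have /choice[h Ah] : forall i, exists s, has_sum (fun j => A i j * f j) s /\ s <= g i.
  move=> i; have [s As sg] : exists2 s, has_sum (fun j => A i j * f j) s & s <= g i.
    by apply: has_sum_dom (Bg i) => j; rewrite ?mulr_ge0 // ler_wpM2r.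
  by exists s.
have h0 : forall i, 0 <= h i by apply: has_sum_ge0_mx (fun i => (Ah i).1).
have [z zh zy] := represents_dom h0 (fun i => (Ah i).2) yg.
exists z, h; split => // [i|]; first exact: (Ah i).1.
by rewrite (le_trans zy) // (le_trans yx) // ler_wpM2r // real_norm_ge0.
Qed.

(** The k-th column of B is B e_k, an element of L to which A applies. Thus every entry of
    [mx_mul A B] is a genuine sum. *)
Lemma positive_bound_has_sum A B a b i k : positive_bound A a ->
  positive_bound B b -> has_sum (fun j => A i j * B j k) (mx_mul A B i k).
Proof.
move=> [A0 Aa] [B0 Bb]; have [e ek _] := represents_unit hL k.
have [y [g [Bg yg _]]] := Bb e _ (fun j => ler0n R (j == k)) ek.
have gE j : g j = B j k.
  apply: has_sum_unique (Bg j) _; have := has_sum_delta k (B j).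
  by under eq_fun do rewrite mulrC [k == _]eq_sym.
have [z [h [Ah _ _]]] := Aa y g (has_sum_ge0_mx B0 (fun j => ler0n R (j == k)) Bg) yg.
have := Ah i; under eq_fun do rewrite gE.
by move=> H; rewrite /mx_mul (has_sum_sum_on H).2.
Qed.

Arguments positive_bound_has_sum {A B a b} i k.

Lemma mx_nonneg_mul A B a b : positive_bound A a -> positive_bound B b ->
  mx_nonneg (mx_mul A B).
Proof.
move=> Aa Bb i k; apply: has_sum_ge0 (positive_bound_has_sum i k Aa Bb) => j.
by rewrite mulr_ge0 ?Aa.1 ?Bb.1.
Qed.

(** Tonelli gives (AB)f = A(Bf) coordinatewise. Here f, g and h are plain sequences, so the result
    also applies to the columns of a third matrix and yields associativity. *)
Lemma has_sum_mx_mul A B a b f g h : (forall i, 0 <= f i) ->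
  positive_bound A a -> positive_bound B b ->
  (forall i, has_sum (fun j => B i j * f j) (g i)) ->
  (forall i, has_sum (fun j => A i j * g j) (h i)) ->
  forall i, has_sum (fun j => mx_mul A B i j * f j) (h i).
Proof.
move=> f0 Aa Bb Bg Ah i.
have [|j|s Fs sh] := @has_sum_exchange _ _ (fun j k => A i j * (B j k * f k)) _ (h i) _ _ (Ah i).
- by move=> j k; rewrite !mulr_ge0 ?Aa.1 ?Bb.1.
- exact/has_sumZ/Bg.
suff -> : (fun k => mx_mul A B i k * f k) = s by [].
apply/funext => k; apply: has_sum_unique (Fs k).
have := has_sumZ (a := f k) (positive_bound_has_sum i k Aa Bb).
rewrite mulrC; under eq_fun do rewrite mulrC -mulrA.
by [].
Qed.

Lemma positive_bound_mul A B a b : 0 <= a -> positive_bound A a ->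
  positive_bound B b -> positive_bound (mx_mul A B) (a * b).
Proof.
move=> a0 Aa Bb; split; first exact: mx_nonneg_mul Aa Bb.
move=> x f f0 xf; have [y [g [Bg yg yx]]] := Bb.2 x f f0 xf.
have g0 := has_sum_ge0_mx Bb.1 f0 Bg.
have [z [h [Ah zh zy]]] := Aa.2 y g g0 yg.
exists z, h; split => //; first exact: has_sum_mx_mul Aa Bb Bg Ah.
by rewrite (le_trans zy) // -mulrA ler_wpM2l.
Qed.

Lemma mx_mulA A B C a b c : 0 <= a -> 0 <= b -> positive_bound A a ->
  positive_bound B b -> positive_bound C c ->
  mx_mul A (mx_mul B C) = mx_mul (mx_mul A B) C.
Proof.
move=> a0 b0 Aa Bb Cc; apply/funext => i; apply/funext => k.
have ABb := positive_bound_mul a0 Aa Bb; have BCb := positive_bound_mul b0 Bb Cc.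
apply: has_sum_unique (positive_bound_has_sum i k ABb Cc).
apply: (@has_sum_mx_mul A B a b (C ^~ k) (mx_mul B C ^~ k) (mx_mul A (mx_mul B C) ^~ k)) => //.
- by move=> j; exact: Cc.1.
- by move=> j; exact: positive_bound_has_sum Bb Cc.
- by move=> j; exact: positive_bound_has_sum Aa BCb.
Qed.

Lemma mx_mul1m A : mx_mul (@mx_one R N) A = A.
Proof.
apply/funext => i; apply/funext => k.
by rewrite /mx_mul (has_sum_sum_on (has_sum_delta i (A ^~ k))).2.
Qed.

Lemma mx_mulm1 A : mx_mul A (@mx_one R N) = A.
Proof.
apply/funext => i; apply/funext => k; rewrite /mx_mul /mx_one.
under eq_fun do rewrite mulrC eq_sym.
by rewrite (has_sum_sum_on (has_sum_delta k (A i))).2.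
Qed.

Lemma positive_bound1 : positive_bound (@mx_one R N) 1.
Proof.
split; first by move=> i j; exact: ler0n.
move=> x f f0 xf; exists x, f; split => // [i|]; last by rewrite mul1r.
exact: has_sum_delta.
Qed.

(** The entry is the i-th coordinate of A e_j, and a coordinate is at most the norm. *)
Lemma positive_bound_entry A a i j : positive_bound A a -> A i j <= a.
Proof.
move=> [A0 Aa]; have [e ej e1] := represents_unit hL j.
have [y [g [Ag yg ye]]] := Aa e _ (fun k => ler0n R (k == j)) ej.
have -> : A i j = g i.
  symmetry; apply: has_sum_unique (Ag i) _; have := has_sum_delta j (A i).
  by under eq_fun do rewrite mulrC [j == _]eq_sym.
by rewrite (le_trans (represents_le_norm hL _ yg)) // (le_trans ye) // e1 mulr1.
Qed.

Lemma positive_bound_lin (I : Type) (r : seq I) (w : I -> R) (F : I -> mx R N) (c : I -> R) :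
  (forall k, 0 <= w k) -> (forall k, positive_bound (F k) (c k)) ->
  positive_bound (fun i j => \sum_(k <- r) w k * F k i j) (\sum_(k <- r) w k * c k).
Proof.
move=> w0 Fc; split.
  by move=> i j; apply: sumr_ge0 => k _; rewrite mulr_ge0 // (Fc k).1.
move=> x f f0 xf.
have /choice[yg Hyg] : forall k, exists yg : L * (idx N -> R),
    [/\ forall i, has_sum (fun j => F k i j * f j) (yg.2 i),
    represents yg.1 yg.2 & nrm yg.1 <= c k * nrm x].
  by move=> k; have [y [g ?]] := (Fc k).2 x f f0 xf; exists (y, g).
exists (\sum_(k <- r) (w k)%:C *: (yg k).1), (fun i => \sum_(k <- r) w k * (yg k).2 i).
split.
- move=> i; under eq_fun do rewrite mulr_suml.
  apply: has_sum_bigsum => k; under eq_fun do rewrite -mulrA.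
  by apply: has_sumZ; have [] := Hyg k.
- apply/funext => i; rewrite bss_coord_sum rmorph_sum; apply: eq_bigr => k _.
  by have [_ H _] := Hyg k; rewrite bss_coordZ H rmorphM.
- rewrite mulr_suml; elim/big_ind2 : _ => [|x1 x2 y1 y2 h1 h2|k _].
  + by rewrite real_norm0.
  + by apply: le_trans (ler_real_normD _ _) _; exact: lerD.
  + by have [_ _ H] := Hyg k; rewrite real_normZr ger0_norm // -mulrA ler_wpM2l.
Qed.

Lemma hadamard_nonneg n (C : 'I_n -> mx R N) : (forall i, mx_nonneg (C i)) ->
  mx_nonneg (hadamard C).
Proof. by move=> C0 i j; apply: prodr_ge0 => k _; exact: C0. Qed.

Lemma hadamard_pow_nonneg A a : mx_nonneg (hadamard_pow A a).
Proof. by move=> i j; exact: powR_ge0. Qed.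

(** The entries of C_k / c_k lie in [0, 1], so the mean inequality, applied entry by entry,
    dominates the Hadamard product by M times the average of the matrices C_k / c_k, each of which
    has bound 1. *)
Lemma positive_bound_hadamard n a (C : 'I_n -> mx R N) (c : 'I_n -> R) :
  (0 < n)%N -> 1 <= n%:R * a ->
  (forall i, 0 < c i) -> (forall i, positive_bound (C i) (c i)) ->
  positive_bound (hadamard (fun i => hadamard_pow (C i) a)) (\prod_(i < n) c i `^ a).
Proof.
move=> n0 na c0 Cc; set M := \prod_(i < n) _.
have M0 : 0 <= M by apply: prodr_ge0 => i _; exact: powR_ge0.
have w0 i : 0 <= M * n%:R^-1 * (c i)^-1.
  by rewrite !mulr_ge0 // invr_ge0 // ltW.
apply: positive_bound_mono (positive_bound_lin (index_enum 'I_n) w0 Cc).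
- by apply: hadamard_nonneg => i; exact: hadamard_pow_nonneg.
- move=> i j; under eq_bigr do rewrite -mulrA; rewrite -mulr_sumr -mulrA.
  have u01 k : 0 <= (c k)^-1 * C k i j <= 1.
    rewrite mulr_ge0 ?invr_ge0 ?(ltW (c0 _)) ?(Cc k).1 //= ler_pdivrMl // mulr1.
    exact: positive_bound_entry (Cc k).
  apply: le_trans (ler_wpM2l M0 (prod_powR_le_mean n0 na u01)).
  rewrite -big_split /= le_eqVlt; apply/orP; left; apply/eqP/eq_bigr => k _.
  rewrite -powRM ?(ltW (c0 _)) //; last by case/andP: (u01 k).
  by rewrite mulVKf // gt_eqF.
- under eq_bigr do rewrite -mulrA mulVf ?gt_eqF // mulr1.
  by rewrite sumr_const card_ord -[_ *+ n]mulr_natr divfK // pnatr_eq0 -lt0n.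
Qed.

End PositiveBound.

Arguments positive_bound_has_sum {R N L} hL {A B a b} i k Aa Bb.
Arguments has_sum_mx_mul {R N L} hL {A B a b f g h} f0 Aa Bb Bg Ah i.

(** * Automatic boundedness of non-negative matrix operators *)

Section Boundedness.
Variables (R : realType) (N : index_set) (L : banach_sequence_space R N).
Hypothesis hL : unit_normalized L.
Implicit Types (A B : mx R N) (x y : L) (f g : idx N -> R).
Local Notation coord := (bss_coord L).
Local Notation nrm := (@real_norm R L).

Lemma norm_Im_le (z : R[i]) : `|complex.Im z|%:C <= `|z|.
Proof. by rewrite normc_def lecR -sqrtr_sqr ler_sqrt ?addr_ge0 ?sqr_ge0 // lerDr sqr_ge0. Qed.

Lemma has_sum_Re f (s : R[i]) :
  has_sum (fun j => (f j)%:C) s -> has_sum f (complex.Re s).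
Proof.
move=> /cvgrPdist_lt fs; apply/cvgrPdist_lt => e e0.
have /fs : 0 < e%:C by rewrite ltcR.
apply: filterS => n; rewrite -(rmorph_sum (real_complex R)) -ltcR.
apply: le_lt_trans; apply: le_trans (normc_ge_Re _).
by rewrite raddfB.
Qed.

(** Closedness of the positive cone is the case p = 0. An inequality in [R[i]] also asserts equality
    of imaginary parts, so the proof passes to the limit separately in the imaginary and the real
    part. *)
Lemma coord_lim_ge (u : nat -> L) x i (p : R) : u @ \oo --> x ->
  (\forall n \near \oo, p%:C <= coord (u n) i) -> p%:C <= coord x i.
Proof.
move=> /cvg_real_normP ux up.
have H (e : R) : 0 < e -> exists2 w : R[i], p%:C <= w & `|coord x i - w| <= e%:C.
  move=> e0; have [n _ /(_ n (leqnn n)) [h1 h2]] := filterI (ux _ e0) up.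
  exists (coord (u n) i) => //; rewrite -bss_coordN -bss_coordD.
  by apply: le_trans (coord_le_norm hL _ _) _; rewrite real_normE lecR ltW.
rewrite lecE /=; apply/andP; split.
  rewrite -normr_le0; apply/ler_addgt0Pr => e /H[w pw]; rewrite add0r.
  move=> /(le_trans (norm_Im_le _)); rewrite raddfB /= lecR.
  by move: pw; rewrite lecE /= => /andP[/eqP -> _]; rewrite subr0.
apply/ler_addgt0Pr => e /H[w pw] /(le_trans (normc_ge_Re _)).
rewrite raddfB /= lecR ler_distl => /andP[h _].
by move: pw; rewrite lecE /= => /andP[_ pw]; lra.
Qed.

Lemma represents_Re x : (forall i, 0 <= coord x i) ->
  represents x (fun i => complex.Re (coord x i)) /\
  forall i, 0 <= complex.Re (coord x i).
Proof.
move=> x0; have E i : (complex.Re (coord x i))%:C = coord x i.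
  by rewrite RRe_real // ger0_real.
by split=> [|i]; [apply/funext => i; rewrite E | rewrite -ler0c E].
Qed.

Lemma defines_operator_act A x f : defines_operator L A -> represents x f ->
  exists y g, (forall i, has_sum (fun j => A i j * f j) (g i)) /\ represents y g.
Proof.
move=> /(_ x)[As [y yA]] xf.
have H i : has_sum (fun j => (A i j * f j)%:C) (coord y i).
  rewrite yA /mx_app; have := summable_has_sum (As i).
  by rewrite xf; under eq_fun do rewrite -rmorphM.
exists y, (fun i => complex.Re (coord y i)); split => [i|].
  exact: has_sum_Re.
apply/funext => i; apply: has_sum_unique (H i) _.
exact/has_sumC/has_sum_Re.
Qed.

(* Gliding hump: if A were unbounded on the positive cone, one could sum a
   series of positive x_n with |x_n| = 2^-n and |A x_n| > 2^n, and A would send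
   its sum s to an element dominating every A x_n. *)
Lemma defines_operator_bounded A : mx_nonneg A -> defines_operator L A ->
  exists2 c, 0 <= c & positive_bound L A c.
Proof.
move=> A0 hA; apply: contrapT => unbounded.
have /choice[X HX] : forall n, exists X : L * (idx N -> R) * (L * (idx N -> R)),
  [/\ (forall i, 0 <= X.1.2 i) /\ represents X.1.1 X.1.2,
      forall i, has_sum (fun j => A i j * X.1.2 j) (X.2.2 i),
      represents X.2.1 X.2.2, nrm X.1.1 = 2^-1 ^+ n & 2 ^+ n < nrm X.2.1].
  move=> n; apply: contrapT => nX; apply: unbounded.
  (* A vector violating the bound 4^n, rescaled to norm 2^-n, has an image of norm above 2^-n 4^n =
     2^n. *)
  exists (4 ^+ n); first exact: exprn_ge0.
  split => // x f f0 xf; have [y [g [Ag yg]]] := defines_operator_act hA xf.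
  exists y, g; split => //; rewrite leNgt; apply/negP => xy; apply: nX.
  have x0 : 0 < nrm x.
    rewrite lt_neqAle real_norm_ge0 andbT eq_sym; apply/eqP => x0.
    have f00 j : f j = 0.
      apply: complexI; have := congr1 (@^~ j) xf; rewrite (real_norm_eq0 x0).
      by rewrite bss_coord0 => <-.
    have g00 i : g i = 0.
      apply: has_sum_unique (Ag i) _; under eq_fun do rewrite f00 mulr0.
      exact: has_sum0.
    move: xy; rewrite x0 mulr0; suff -> : y = 0 by rewrite real_norm0 ltxx.
    apply: (represents_inj yg); have -> : g = fun=> 0 by apply/funext.
    exact: represents0.
  pose l := (2^-1 ^+ n) / nrm x.
  have l0 : 0 < l by rewrite divr_gt0 // exprn_gt0 // invr_gt0.
  exists ((l%:C *: x, fun i => l * f i), (l%:C *: y, fun i => l * g i)) => /=.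
  split => //.
  - split=> [i|]; first by rewrite mulr_ge0 // ltW.
    by have := represents_lin l xf (represents0 L); rewrite addr0; under eq_fun do rewrite addr0.
  - move=> i; under eq_fun do rewrite mulrCA.
    exact: has_sumZ.
  - by have := represents_lin l yg (represents0 L); rewrite addr0; under eq_fun do rewrite addr0.
  - by rewrite real_normZr gtr0_norm // divfK // gt_eqF.
  - rewrite real_normZr gtr0_norm //.
    rewrite mulrAC ltr_pdivlMr //.
    apply: le_lt_trans (_ : 2^-1 ^+ n * (4 ^+ n * nrm x) < _); last first.
      by rewrite ltr_pM2l // exprn_gt0 // invr_gt0.
    rewrite mulrA -exprMn ler_wpM2r ?real_norm_ge0 //.
    by have -> : 2^-1 * 4 = 2 :> R by lra.
have /cvg_ex[s us] : cvgn (series (fun n => (X n).1.1)).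
  apply: (cvg_series_geometric (C := 1) (q := 2^-1)) => [|n]; first by lra.
  by have [_ _ _ -> _] := HX n; rewrite mul1r.
(* From index n + 1 on, the partial sums contain the n-th vector and otherwise only non-negative
   terms. *)
have Xs n i : ((X n).1.2 i)%:C <= coord s i.
  apply: coord_lim_ge us _; exists n.+1 => // k /= nk.
  rewrite /series /= bss_coord_sum /index_iota subn0 (bigD1_seq n) ?iota_uniq ?mem_iota //=.
  have [[_ ->] _ _ _ _] := HX n; rewrite lerDl sumr_ge0 // => j _.
  by have [[f0 ->] _ _ _ _] := HX j; rewrite ler0c.
have [|sF _] := @represents_Re s.
  move=> i; apply: le_trans (Xs 0%N i).
  by have [[f0 _] _ _ _ _] := HX 0%N; rewrite ler0c.
have [y [g [Ag yg]]] := defines_operator_act hA sF.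
have big n : 2 ^+ n < nrm y.
  have [[f0 _] Xg rg _ /lt_le_trans] := HX n; apply.
  apply: represents_le rg yg => i.
    by apply: has_sum_ge0 (Xg i) => j; rewrite mulr_ge0.
  apply: ler_has_sum (Xg i) (Ag i) => j; apply: ler_wpM2l => //.
  by have := Xs n j; rewrite lecE => /andP[].
have := big (Num.bound (nrm y)); apply/negP; rewrite -leNgt.
apply: le_trans (ltW (archi_boundP (real_norm_ge0 y))) _.
by rewrite -natrX ler_nat ltnW // ltn_expl.
Qed.

End Boundedness.

(** * The operator of a positive matrix on the complex space *)

Section Operator.
Variables (R : realType) (N : index_set) (L : banach_sequence_space R N).
Hypothesis hL : unit_normalized L.
Implicit Types (A B : mx R N) (x y : L) (f g : idx N -> R).
Local Notation coord := (bss_coord L).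
Local Notation nrm := (@real_norm R L).

Lemma represents_pos_part x (h : idx N -> R) :
  (forall i, `|h i|%:C <= `|coord x i|) ->
  exists p n, [/\ represents p (fun i => Num.max (h i) 0),
    represents n (fun i => Num.max (- h i) 0), nrm p <= nrm x & nrm n <= nrm x].
Proof.
move=> hx.
have D (u : idx N -> R) : (forall i, `|u i| <= `|h i|) ->
    exists2 z, represents z u & nrm z <= nrm x.
  move=> uh; apply: coord_dom => i; apply: le_trans (hx i).
  by rewrite normc_def /= expr0n addr0 sqrtr_sqr lecR.
have [|p hp px] := D (fun i => Num.max (h i) 0).
  by move=> i; rewrite /Num.max; case: ifP => _; rewrite ?normr0 ?normrN ?normr_ge0 ?lexx.
have [|n hn nx] := D (fun i => Num.max (- h i) 0).
  by move=> i; rewrite /Num.max; case: ifP => _; rewrite ?normr0 ?normrN ?normr_ge0 ?lexx.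
by exists p, n.
Qed.

Lemma max_sub_max (r : R) : Num.max r 0 - Num.max (- r) 0 = r.
Proof. by case: (leP r 0) => ?; case: (leP (- r) 0) => ?; lra. Qed.

Definition positive x := forall i, 0 <= coord x i.

Lemma represents_positive x f : (forall i, 0 <= f i) -> represents x f -> positive x.
Proof. by move=> f0 xf i; rewrite xf ler0c. Qed.

Lemma positive_decomposition x : exists p1 p2 p3 p4,
  [/\ [/\ positive p1, positive p2, positive p3 & positive p4],
      [/\ nrm p1 <= nrm x, nrm p2 <= nrm x, nrm p3 <= nrm x & nrm p4 <= nrm x] &
      x = (p1 - p2) + ('i%C : R[i]) *: (p3 - p4)].
Proof.
have [p1 [p2 [r1 r2 n1 n2]]] := represents_pos_part (fun i => normc_ge_Re (coord x i)).
have [p3 [p4 [r3 r4 n3 n4]]] := represents_pos_part (fun i => norm_Im_le (coord x i)).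
exists p1, p2, p3, p4; split => //.
  have pos p (h : idx N -> R) : represents p (fun i => Num.max (h i) 0) -> positive p.
    by move=> ph; apply: (represents_positive _ ph) => i; rewrite le_max lexx orbT.
  by split; [exact: pos r1|exact: pos r2|exact: pos r3|exact: pos r4].
apply: (@coord_inj _ _ L); apply/funext => i.
rewrite bss_coordD bss_coordZ !bss_coordD !bss_coordN r1 r2 r3 r4.
by rewrite -!rmorphB /= !max_sub_max; exact: complexE.
Qed.

(** Carries statements compatible with linear combinations from the cone, where sums are real and
    non-negative, to all of L. *)
Lemma positive_ind (P : L -> Prop) : (forall x, positive x -> P x) ->
  (forall a x y, P x -> P y -> P (a *: x + y)) -> forall x, P x.
Proof.
move=> Ppos Plin x; have [p1 [p2 [p3 [p4 [[/Ppos h1 /Ppos h2 /Ppos h3 /Ppos h4] _ ->]]]]] :=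
  positive_decomposition x.
rewrite [_ + _ *: _]addrC; apply: (Plin).
  by rewrite addrC -scaleN1r; exact: Plin.
by rewrite addrC -scaleN1r; exact: Plin.
Qed.

Section OneOperator.
Variables (A : mx R N) (a : R).
Hypothesis Aa : positive_bound L A a.
Local Notation T := (mx_operator L A).

Lemma positive_bound_has_sumC x : exists y : L,
  forall i, has_sum (fun j => (A i j)%:C * coord x j) (coord y i).
Proof.
elim/positive_ind: x => [x x0|b x y [x' Hx] [y' Hy]].
- have [rx f0] := represents_Re x0; have [y [g [Ag yg _]]] := Aa.2 x _ f0 rx.
  exists y => i; have := has_sumC (Ag i).
  by rewrite rx yg; under eq_fun do rewrite rmorphM.
- exists (b *: x' + y') => i; rewrite coord_linear.
  have := has_sum_lin (a := b) (Hx i) (Hy i).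
  by under eq_fun do rewrite mulrCA -mulrDr -coord_linear.
Qed.

(** The default value 0 in [mx_operator] is excluded: the row sums converge and are the coordinates
    of an element of L. *)
Lemma mx_operator_has_sum x i :
  has_sum (fun j => (A i j)%:C * coord x j) (coord (T x) i).
Proof.
have [y Hy] := positive_bound_has_sumC x.
have yA : coord y = mx_app A (coord x).
  by apply/funext => k; rewrite /mx_app (has_sum_sum_on (Hy k)).2.
rewrite /mx_operator; case: xgetP => [z _ zA|/(_ y)]; last by rewrite /= yA.
suff -> : z = y by exact: Hy.
by apply: (@coord_inj _ _ L); rewrite yA.
Qed.

Arguments mx_operator_has_sum : clear implicits.

Lemma mx_operator_unique x y :
  (forall i, has_sum (fun j => (A i j)%:C * coord x j) (coord y i)) -> T x = y.
Proof.
move=> Hy; apply: (@coord_inj _ _ L); apply/funext => i.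
exact: has_sum_unique (mx_operator_has_sum x i) (Hy i).
Qed.

Lemma mx_operator_linear b x y : T (b *: x + y) = b *: T x + T y.
Proof.
apply: mx_operator_unique => i; rewrite coord_linear.
have := has_sum_lin (a := b) (mx_operator_has_sum x i) (mx_operator_has_sum y i).
by under eq_fun do rewrite mulrCA -mulrDr -coord_linear.
Qed.

Lemma mx_operator_represents x f : (forall i, 0 <= f i) -> represents x f ->
  exists g, [/\ forall i, has_sum (fun j => A i j * f j) (g i),
    represents (T x) g & nrm (T x) <= a * nrm x].
Proof.
move=> f0 xf; have [y [g [Ag yg yx]]] := Aa.2 x f f0 xf; exists g.
have -> // : T x = y.
apply: mx_operator_unique => i; have := has_sumC (Ag i).
by rewrite xf yg; under eq_fun do rewrite rmorphM.
Qed.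

Lemma mx_operator_positive x : positive x -> positive (T x).
Proof.
move=> /represents_Re[xr f0]; have [g [Ag Tg _]] := mx_operator_represents f0 xr.
exact: represents_positive (has_sum_ge0_mx Aa.1 f0 Ag) Tg.
Qed.

Lemma mx_operator_positive_norm x : positive x -> nrm (T x) <= a * nrm x.
Proof. by move=> /represents_Re[xr f0]; have [g []] := mx_operator_represents f0 xr. Qed.

Lemma mx_operator_norm x : 0 <= a -> nrm (T x) <= 4 * a * nrm x.
Proof.
move=> a0.
have [p1 [p2 [p3 [p4 [[h1 h2 h3 h4] [n1 n2 n3 n4] xE]]]]] := positive_decomposition x.
have TD u v : T (u + v) = T u + T v.
  by have := mx_operator_linear 1 u v; rewrite !scale1r.
have TB u v : T (u - v) = T u - T v.
  by rewrite addrC -scaleN1r mx_operator_linear scaleN1r addrC.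
have TZ b u : T (b *: u) = b *: T u.
  have T0 : T 0 = 0 by have := TB 0 0; rewrite !subrr.
  by have := mx_operator_linear b u 0; rewrite T0 !addr0.
rewrite {1}xE TD TZ !TB; apply: le_trans (ler_real_normD _ _) _.
rewrite real_normZ.
have -> : complex.Re `|('i%C : R[i])| = 1.
  by rewrite normc_def /= expr0n add0r expr1n sqrtr1.
have bd p : positive p -> nrm p <= nrm x -> nrm (T p) <= a * nrm x.
  by move=> /mx_operator_positive_norm /le_trans h /(ler_wpM2l a0) /h.
have h12 : nrm (T p1 - T p2) <= nrm (T p1) + nrm (T p2).
  by rewrite -(real_normN (T p2)) ler_real_normD.
have h34 : nrm (T p3 - T p4) <= nrm (T p3) + nrm (T p4).
  by rewrite -(real_normN (T p4)) ler_real_normD.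
have := bd _ h1 n1; have := bd _ h2 n2; have := bd _ h3 n3; have := bd _ h4 n4.
by rewrite mul1r -mulrA; lra.
Qed.

End OneOperator.

Lemma mx_operator_mul A B a b : 0 <= a -> positive_bound L A a ->
  positive_bound L B b ->
  mx_operator L (mx_mul A B) =1 mx_operator L A \o mx_operator L B.
Proof.
move=> a0 Aa Bb; have ABb := positive_bound_mul hL a0 Aa Bb.
elim/positive_ind => [x x0|c x y /= IHx IHy].
- have [xr f0] := represents_Re x0.
  have [g [Bg yg _]] := mx_operator_represents Bb f0 xr.
  have g0 := has_sum_ge0_mx Bb.1 f0 Bg.
  have [h [Ah zh _]] := mx_operator_represents Aa g0 yg.
  apply: (mx_operator_unique ABb) => i /=.
  have := has_sumC (has_sum_mx_mul hL f0 Aa Bb Bg Ah i).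
  by rewrite xr zh; under eq_fun do rewrite rmorphM.
- by rewrite (mx_operator_linear ABb) (mx_operator_linear Bb)
    (mx_operator_linear Aa) IHx IHy.
Qed.

Lemma mx_operator1 : mx_operator L (@mx_one R N) =1 id.
Proof.
move=> x; apply: (mx_operator_unique (positive_bound1 L)) => i.
have := has_sum_delta i (coord x); congr has_sum; apply/funext => j.
by rewrite /mx_one rmorph_nat.
Qed.

End Operator.

(** * Resolvents and the spectral radius *)

Section Resolvent.
Variables (R : realType) (V : completeNormedModType R[i]).
Implicit Types (x y : V) (l : R[i]) (S T : V -> V) (M C mu : R).
Local Notation nrm := (@real_norm R V).

Definition bounded_by T M := forall x, nrm (T x) <= M * nrm x.

Definition resolvent T l S := [/\ linear S, exists M, bounded_by S M,
  forall x, S (l *: x - T x) = x & forall x, l *: S x - T (S x) = x].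

Lemma continuous_bounded_by (S : {linear V -> V}) :
  continuous S <-> exists M, bounded_by S M.
Proof.
rewrite -linear_bounded_continuous linear_boundedP; split.
- move=> [[M M'] [Mreal MS]]; have M'0 : M' = 0.
    by move: Mreal; rewrite complex_real => /eqP.
  exists (M + 1) => x; have := MS (M + 1)%:C; rewrite M'0 ltcR ltrDl ltr01.
  by move=> /(_ isT x); rewrite !real_normE -rmorphM lecR.
- move=> [M SM]; exists M%:C; split; first by rewrite complex_real.
  move=> r /ltW Mr x; rewrite (le_trans _ (ler_wpM2r (normr_ge0 x) Mr)) //.
  by rewrite !real_normE -rmorphM lecR.
Qed.

Lemma spectrumPn T l : ~ spectrum T l <-> exists S, resolvent T l S.
Proof.
split=> [/contrapT[S [Sc SK KS]]|[S [Slin Sb SK KS]]].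
- exists S; split => //; first exact: linearP.
  exact/continuous_bounded_by.
- apply; pose SL : {linear V -> V} := HB.pack S (GRing.isLinear.Build _ _ _ _ S Slin).
  by exists SL; split => //; apply/continuous_bounded_by.
Qed.

Lemma linear_laws T : linear T ->
  [/\ T 0 = 0, forall a x, T (a *: x) = a *: T x,
      forall x y, T (x + y) = T x + T y & forall x y, T (x - y) = T x - T y].
Proof.
move=> Tlin.
have TB x y : T (x - y) = T x - T y by rewrite addrC -scaleN1r Tlin scaleN1r addrC.
have T0 : T 0 = 0 by have := TB 0 0; rewrite !subrr.
split => // [a x|x y]; first by have := Tlin a x 0; rewrite T0 !addr0.
by have := Tlin 1 x y; rewrite !scale1r.
Qed.

Lemma iter_linear T k : linear T -> linear (iter k T).
Proof. by move=> Tlin; elim: k => [|k IH] a x y //=; rewrite IH Tlin. Qed.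

Lemma cvg_bounded_by T M (u : nat -> V) x : linear T -> bounded_by T M ->
  u @ \oo --> x -> (T \o u) @ \oo --> T x.
Proof.
move=> Tlin TM /cvg_real_normP ux; apply/cvg_real_normP => e e0.
have [_ _ _ TB] := linear_laws Tlin.
pose M' := Num.max M 1; have M0 : 0 < M' by rewrite lt_max ltr01 orbT.
apply: filterS (ux (e / M') (divr_gt0 e0 M0)) => n.
rewrite ltr_pdivlMr // mulrC; apply: le_lt_trans.
rewrite /= -TB (le_trans (TM _)) // ler_wpM2r ?real_norm_ge0 //.
by rewrite le_max lexx.
Qed.

(** The series of l^-(k+1) T^k x converges geometrically with ratio q = mu / |l|, even when the norm
    of T itself exceeds |l|. *)
Lemma neumann_resolvent T C mu l : linear T -> 0 < mu -> mu < complex.Re `|l| ->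
  (forall k, bounded_by (iter k T) (C * mu ^+ k)) -> exists S, resolvent T l S.
Proof.
move=> Tlin mu0 mul TC; have [T0 TZ TD TB] := linear_laws Tlin.
set r := complex.Re `|l| in mul; have r0 : 0 < r by exact: lt_trans mul.
have l0 : l != 0.
  by apply/eqP => l0; move: r0; rewrite /r l0 normr0 ltxx.
have rV k : complex.Re `|l ^- k| = r ^- k.
  have lE : `|l| = r%:C by rewrite [RHS]RRe_real // normr_real.
  by rewrite normrV ?unitfE ?expf_neq0 // normrX lE -rmorphXn -fmorphV.
pose u x k := l ^- k.+1 *: iter k T x.
pose q := mu / r; have q0 : 0 < q by rewrite divr_gt0.
have q1 : q < 1 by rewrite ltr_pdivrMr // mul1r.
have uq x k : nrm (u x k) <= C * r^-1 * nrm x * q ^+ k.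
  rewrite /u real_normZ rV.
  apply: (le_trans (ler_wpM2l _ (TC k x))); first by rewrite invr_ge0 exprn_ge0 // ltW.
  rewrite /q expr_div_n exprSr invfM le_eqVlt; apply/orP; left; apply/eqP.
  by ring.
have /choice[S uS] : forall x, exists s : V, series (u x) @ \oo --> s.
  move=> x; apply/cvg_ex; apply: (cvg_series_geometric (q := q)) (uq x).
  by rewrite ltW.
have ulin a x y n : series (u (a *: x + y)) n = a *: series (u x) n + series (u y) n.
  rewrite /series /= scaler_sumr -big_split /=; apply: eq_bigr => k _.
  by rewrite /u iter_linear // scalerDr !scalerA mulrC.
have Slin : linear S.
  move=> a x y; apply: (cvg_unique (@norm_hausdorff _ V) (uS _)).
  have -> : series (u (a *: x + y)) = fun n => a *: series (u x) n + series (u y) n.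
    exact/funext.
  by apply: cvgD (uS y); apply: cvgZr.
(* Non-negativity is read off the growth bound at k = 0. *)
have C0 x : 0 <= C * r^-1 * nrm x.
  have := uq x 0%N; rewrite expr0 mulr1; apply: le_trans; exact: real_norm_ge0.
have Sb : bounded_by S (C * r^-1 * (1 - q)^-1).
  move=> x; apply: real_norm_lim (uS x) _ => n.
  have := geometric_le_lim n (C0 x) q0; rewrite gtr0_norm // => /(_ q1) H.
  rewrite mulrAC; apply: le_trans H; rewrite /series /=.
  elim/big_ind2 : _ => [|x1 x2 y1 y2 h1 h2|k _]; last exact: uq.
    by rewrite real_norm0.
  by apply: le_trans (ler_real_normD _ _) _; exact: lerD.
pose w x n := l ^- n *: iter n T x.
have wto x : w x @ \oo --> 0.
  apply/cvg_real_normP => e e0.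
  have /cvgrPdist_lt/(_ e e0) : geometric (C * nrm x) q @ \oo --> 0.
    by apply: cvg_geometric; rewrite gtr0_norm.
  apply: filterS => n; rewrite !sub0r normrN real_normN /w real_normZ rV.
  apply: le_lt_trans; apply: le_trans (ler_norm _).
  apply: (le_trans (ler_wpM2l _ (TC n x))); first by rewrite invr_ge0 exprn_ge0 // ltW.
  rewrite /= /q expr_div_n le_eqVlt; apply/orP; left; apply/eqP.
  by ring.
(* Telescoping: the remainder l^-n T^n x tends to 0, so the sum is a right inverse of l - T. *)
have tele x n : l *: series (u x) n - T (series (u x) n) = x - w x n.
  elim: n => [|n IH].
    by rewrite /series /= big_geq // T0 scaler0 subrr /w expr0 invr1 scale1r subrr.
  rewrite seriesSr TD scalerDr opprD addrACA IH /w /u TZ -iterS scalerA.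
  by rewrite exprS invfM mulVKf // addrA subrK.
have xw x : (fun n => x - w x n) @ \oo --> x.
  by rewrite -[X in _ --> X]subr0; apply: cvgB (wto x); exact: cvg_cst.
have Tb : bounded_by T (C * mu) by have := TC 1%N; rewrite expr1.
have KS x : l *: S x - T (S x) = x.
  apply: (cvg_unique (@norm_hausdorff _ V) _ (xw x)).
  have -> : (fun n => x - w x n) = fun n => l *: series (u x) n - T (series (u x) n).
    by apply/funext => n; rewrite tele.
  by apply: cvgB; [apply: cvgZr; exact: uS | exact: cvg_bounded_by (uS x)].
(* The partial sums commute with T, hence so does S, and the right inverse is also a left
   inverse. *)
have comm x : S (T x) = T (S x).
  apply: (cvg_unique (@norm_hausdorff _ V) (uS (T x))).
  suff -> : series (u (T x)) = T \o series (u x) by exact: cvg_bounded_by (uS x).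
  apply/funext => n; elim: n => [|n IH].
    by rewrite /= /series /= !big_geq.
  by rewrite /= !seriesSr IH TD /u TZ -iterSr -iterS.
exists S; split => //; first by exists (C * r^-1 * (1 - q)^-1).
by move=> x; have [_ SZ _ SB] := linear_laws Slin; rewrite SB SZ comm KS.
Qed.

(** [sup] has the value 0 on an empty or unbounded set; otherwise it dominates some modulus. *)
Lemma spectral_radius_ge0 T : 0 <= spectral_radius T.
Proof.
rewrite /spectral_radius; set E := (X in sup X).
have [[[r Er] ubE]|/sup_out -> //] := pselect (has_sup E).
apply: le_trans (ub_le_sup ubE Er).
by case: Er => l _ <-; rewrite -lecR RRe_real ?normr_ge0 // normr_real.
Qed.

Lemma spectral_radius_le T mu : 0 <= mu ->
  (forall l, mu < complex.Re `|l| -> exists S, resolvent T l S) ->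
  spectral_radius T <= mu.
Proof.
move=> mu0 H; rewrite /spectral_radius; set E := (X in sup X).
have [E0|nE] := pselect (nonempty E); last first.
  by rewrite sup_out // => -[].
apply: ge_sup => // _ [l Tl <-]; rewrite leNgt; apply/negP => /H/spectrumPn.
exact.
Qed.

(** The supremum is an upper bound only if the spectrum is bounded, and the Neumann series beyond
    the norm of T shows that it is. *)
Lemma resolvent_above_radius T M l : linear T -> bounded_by T M ->
  spectral_radius T < complex.Re `|l| -> exists S, resolvent T l S.
Proof.
move=> Tlin TM; rewrite ltNge => rl; apply/spectrumPn => Tl.
suff ubE : has_ubound [set complex.Re `|k| | k in spectrum T].
  by move/negP: rl; apply; apply: (ub_le_sup ubE); exists l.
pose M' := Num.max M 1; have M0 : 0 < M' by rewrite lt_max ltr01 orbT.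
have TM' x : nrm (T x) <= M' * nrm x.
  by apply: le_trans (TM x) _; rewrite ler_wpM2r ?real_norm_ge0 // le_max lexx.
exists M' => _ [k Tk <-]; rewrite leNgt; apply/negP => Mk.
move: Tk; apply/spectrumPn; apply: (neumann_resolvent (C := 1) Tlin M0 Mk).
elim=> [|j IH] x /=; first by rewrite expr0 !mul1r.
apply: le_trans (TM' _) _; apply: le_trans (ler_wpM2l (ltW M0) (IH x)) _.
by rewrite exprS !mul1r mulrA.
Qed.

End Resolvent.

(** * Positivity of the resolvent above the spectral radius *)

Section PositiveResolvent.
Variables (R : realType) (N : index_set) (L : banach_sequence_space R N).
Hypothesis hL : unit_normalized L.
Implicit Types (A B : mx R N) (x y : L) (S U : L -> L) (a K l : R).
Local Notation coord := (bss_coord L).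
Local Notation nrm := (@real_norm R L).

Lemma positiveD x y : positive x -> positive y -> positive (x + y).
Proof. by move=> x0 y0 i; rewrite bss_coordD addr_ge0. Qed.

Lemma positiveZ l x : 0 <= l -> positive x -> positive (l%:C *: x).
Proof. by move=> l0 x0 i; rewrite bss_coordZ mulr_ge0 // ler0c. Qed.

Lemma positive_norm_le x y : positive x -> positive (y - x) -> nrm x <= nrm y.
Proof.
move=> x0 yx0; have y0 : positive y by rewrite -(subrK x y); exact: positiveD.
have [[xr f0] [yr _]] := (represents_Re x0, represents_Re y0).
apply: represents_le f0 _ xr yr => i; have := yx0 i.
by rewrite bss_coordD bss_coordN subr_ge0 lecE => /andP[].
Qed.

(** Inductively y - U^(n+1) y = w + U(y - U^n y) is positive; U^n y tends to 0 and the cone is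
    closed. *)
Lemma positive_fixpoint U (q : R) (w y : L) : linear U ->
  (forall x, positive x -> positive (U x)) -> 0 <= q < 1 -> bounded_by U q ->
  positive w -> y = w + U y -> positive y.
Proof.
move=> Ulin Upos /andP[q0 q1] Uq w0 yE i.
have [_ _ UD _] := linear_laws Ulin.
have pn n : positive (y - iter n U y).
  elim: n => [|n IH]; first by move=> j; rewrite subrr bss_coord0.
  have -> : y - iter n.+1 U y = w + U (y - iter n U y).
    by have [_ _ _ ->] := linear_laws Ulin; rewrite addrA -yE.
  by apply: positiveD => //; exact: Upos.
have Un n : nrm (iter n U y) <= nrm y * q ^+ n.
  elim: n => [|n IH]; first by rewrite expr0 mulr1.
  by rewrite /= (le_trans (Uq _)) // exprS mulrCA ler_wpM2l.
have lim : (fun n => y - iter n U y) @ \oo --> y.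
  apply/cvg_real_normP => e e0.
  have /cvgrPdist_lt/(_ e e0) : geometric (nrm y) q @ \oo --> 0.
    by apply: cvg_geometric; rewrite ger0_norm.
  apply: filterS => n; rewrite sub0r normrN opprB addrC subrK.
  by apply: le_lt_trans; apply: le_trans (ler_norm _); exact: Un.
by apply: (coord_lim_ge hL (p := 0)) lim _; apply: nearW => n; exact: pn.
Qed.

Section Descent.
Variables (A : mx R N) (a : R).
Hypotheses (a_ge0 : 0 <= a) (Aa : positive_bound L A a).
Local Notation T := (mx_operator L A).

Let T_linear : linear T. Proof. by move=> b x y; exact: (mx_operator_linear Aa). Qed.

Definition positive_operator S := forall x, positive x -> positive (S x).

Lemma resolvent_scaled l S x : resolvent T l%:C S ->
  l%:C *: S x = x + T (S x).
Proof. by move=> [_ _ _ /(_ x) KS]; rewrite -[X in X + _]KS subrK. Qed.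

(* R_l x solves y = x / l + T y / l, a contraction for large l. *)
Lemma resolvent_positive_large l S : 4 * a < l -> resolvent T l%:C S ->
  positive_operator S.
Proof.
move=> al Sres x x0; have l0 : 0 < l by apply: le_lt_trans al; rewrite mulr_ge0.
have [_ TZ _ _] := linear_laws T_linear.
apply: (@positive_fixpoint (fun y => l^-1%:C *: T y) (4 * a / l) (l^-1%:C *: x)).
- by move=> b u v; rewrite T_linear scalerDr !scalerA [_ * b]mulrC.
- by move=> u u0; apply: positiveZ; [rewrite invr_ge0 ltW | exact: mx_operator_positive Aa _ u0].
- by rewrite divr_ge0 ?mulr_ge0 ?(ltW l0) //= ltr_pdivrMr // mul1r.
- move=> u; rewrite real_normZr gtr0_norm ?invr_gt0 // mulrC.
  rewrite mulrAC ler_pM2r ?invr_gt0 //; exact: mx_operator_norm.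
- by apply: positiveZ => //; rewrite invr_ge0 ltW.
- rewrite -scalerDr -(resolvent_scaled x Sres) scalerA -rmorphM mulVf ?gt_eqF //.
  by rewrite scale1r.
Qed.

(* R_(l-d) x solves y = R_l x + d R_l y. *)
Lemma resolvent_positive_below l d K S S' : 0 <= d -> 0 <= K -> d * K < 1 ->
  resolvent T l%:C S -> bounded_by S K -> positive_operator S ->
  resolvent T (l - d)%:C S' -> positive_operator S'.
Proof.
move=> d0 K0 dK [Slin _ SK _] Sb Spos S'res x x0.
have [_ SZ SD _] := linear_laws Slin.
apply: (@positive_fixpoint (fun y => d%:C *: S y) (d * K) (S x)).
- by move=> b u v; rewrite Slin scalerDr !scalerA [_ * b]mulrC.
- by move=> u u0; apply: positiveZ => //; exact: Spos.
- by rewrite mulr_ge0.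
- by move=> u; rewrite real_normZr ger0_norm // -mulrA ler_wpM2l.
- exact: Spos.
- rewrite -SZ -SD -[LHS]SK; congr S.
  have := resolvent_scaled x S'res; rewrite rmorphB scalerBl => /eqP.
  by rewrite subr_eq addrAC => /eqP ->; rewrite addrK.
Qed.

(** In the identity S' = S + (l - l') S S' the last term has at most half the norm of S' x and is
    absorbed on the left. *)
Lemma resolvent_bound_near l l' K S S' : 0 <= K -> `|l - l'| * K <= 2^-1 ->
  resolvent T l%:C S -> bounded_by S K -> resolvent T l'%:C S' ->
  bounded_by S' (2 * K).
Proof.
move=> K0 dK [Slin _ SK _] Sb S'res x.
have [_ SZ SD _] := linear_laws Slin.
have E : S' x = S x + (l - l')%:C *: S (S' x).
  rewrite -SZ -SD -[LHS]SK; congr S.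
  have := resolvent_scaled x S'res; rewrite rmorphB scalerBl => ->.
  by rewrite opprD addrCA addNKr.
have := ler_real_normD (S x) ((l - l')%:C *: S (S' x)); rewrite -E real_normZr.
have := Sb x; have := ler_wpM2l (normr_ge0 (l - l')) (Sb (S' x)).
have := ler_wpM2r (real_norm_ge0 (S' x)) dK; rewrite mulrA.
by lra.
Qed.

Lemma bounded_by_ge1 S : (exists M, bounded_by S M) -> exists2 K, 1 <= K & bounded_by S K.
Proof.
move=> [M SM]; exists (Num.max M 1); first by rewrite le_max lexx orbT.
by move=> x; rewrite (le_trans (SM x)) // ler_wpM2r ?real_norm_ge0 // le_max lexx.
Qed.

(* Positivity of the resolvent holds for large l and propagates downwards as
   long as the resolvent exists, so it reaches every l above the spectral
   radius: the infimum of the good l cannot exceed mu. *)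
Lemma positive_resolvent mu : rho L A < mu ->
  exists2 S, resolvent T mu%:C S & positive_operator S.
Proof.
move=> rmu; have mu0 : 0 < mu by apply: le_lt_trans rmu; exact: spectral_radius_ge0.
have res l : mu <= l -> exists S, resolvent T l%:C S.
  move=> mul; apply: (@resolvent_above_radius _ _ _ (4 * a)) => //.
    by move=> x; exact: mx_operator_norm.
  by rewrite Re_norm_real gtr0_norm ?(lt_le_trans mu0) // (lt_le_trans rmu).
pose E := [set l | mu <= l /\ exists2 S, resolvent T l%:C S & positive_operator S].
have Elb : lbound E mu by move=> l [].
have EI : has_inf E.
  split; last by exists mu.
  pose l := Num.max mu (4 * a + 1); exists l.
  have mul : mu <= l by rewrite le_max lexx.
  split=> //; have [S Sres] := res _ mul; exists S => //.
  by apply: resolvent_positive_large Sres; rewrite lt_max ltrDl ltr01 orbT.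
have mu_inf : mu <= inf E by apply: lb_le_inf => //; exact: EI.1.
have [R1 R1res] := res _ mu_inf.
have [K K1 R1K] : exists2 K, 1 <= K & bounded_by R1 K.
  by apply: bounded_by_ge1; have [] := R1res.
have K0 : 0 < K by exact: lt_le_trans K1.
(* K bounds the resolvent at inf E, so 2 K bounds it at any l of E within d of inf E. A descent from
   l to at most d/2 below inf E has length below 3d/2, and (3d/2)(2K) = 3/4 < 1. *)
pose d := (4 * K)^-1; have d0 : 0 < d by rewrite invr_gt0 mulr_gt0.
have dK : d * K = 4^-1 by rewrite /d invfM -mulrA mulVf ?mulr1 // gt_eqF.
have [l [mul [S Sres Spos]] ld] := inf_adherent d0 EI.
have infl : inf E <= l by apply: ge_inf; [exact: EI.2 | split => //; exists S].
have SK : bounded_by S (2 * K).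
  apply: resolvent_bound_near R1res R1K Sres; first exact: ltW.
  rewrite ler0_norm ?subr_le0 // opprB.
  apply: (@le_trans _ _ (d * K)); last by rewrite dK; lra.
  by rewrite ler_wpM2r ?(ltW K0) //; lra.
pose l' := Num.max mu (inf E - d / 2).
have mul' : mu <= l' by rewrite le_max lexx.
have l'l : l' <= l by rewrite ge_max mul /=; lra.
have [S' S'res] := res _ mul'.
have S'pos : positive_operator S'.
  apply: (@resolvent_positive_below l (l - l') (2 * K) S) => //.
  - by rewrite subr_ge0.
  - by rewrite mulr_ge0 // ltW.
  - have l'd : inf E - d / 2 <= l' by rewrite le_max lexx orbT.
    apply: (@lt_trans _ _ (3 / 2 * d * (2 * K))).
      by rewrite ltr_pM2r ?mulr_gt0 //; lra.
    have -> : 3 / 2 * d * (2 * K) = 3 * (d * K) by field.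
    by rewrite dK; lra.
  - by rewrite opprB addrC subrK.
(* Since l' belongs to E, either inf E <= mu or inf E <= inf E - d/2; the second is absurd, and the
   first gives l' = mu. *)
have : inf E <= l' by apply: ge_inf; [exact: EI.2 | split => //; exists S'].
rewrite /l' le_max => /orP[infmu|]; last by lra.
have E' : inf E = mu by apply/eqP; rewrite eq_le infmu.
have l'mu : l' = mu by rewrite /l' E'; apply/max_idPl; lra.
by exists S'; rewrite -?l'mu.
Qed.

End Descent.

End PositiveResolvent.

(** * Products, powers and Hadamard powers *)

Section MatrixProducts.
Variables (R : realType) (N : index_set) (L : banach_sequence_space R N).
Hypothesis hL : unit_normalized L.
Implicit Types (A B C : mx R N) (a b c mu : R).

Definition bounded_positive A := exists2 c, 0 < c & positive_bound L A c.

Local Notation "'mprod_' ( i <- r ) F" :=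
  (\big[@mx_mul R N/@mx_one R N]_(i <- r) F) (at level 41, i, r at level 50).

Lemma positive_bound_weaken A a b : a <= b -> positive_bound L A a -> positive_bound L A b.
Proof. by move=> ab Aa; apply: (positive_bound_mono Aa.1 _ ab Aa). Qed.

Lemma defines_bounded_positive A : mx_nonneg A -> defines_operator L A -> bounded_positive A.
Proof.
move=> A0 /(defines_operator_bounded hL A0)[c c0 Ac]; exists (c + 1).
  by rewrite ltr_wpDl.
by apply: positive_bound_weaken Ac; rewrite lerDl.
Qed.

Lemma bounded_positive_ge0 A : bounded_positive A -> mx_nonneg A.
Proof. by move=> [c _ []]. Qed.

Lemma bounded_positive_mono A B : mx_nonneg A -> mx_le A B ->
  bounded_positive B -> bounded_positive A.
Proof. by move=> A0 AB [c c0 Bc]; exists c => //; exact: positive_bound_mono Bc. Qed.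

Lemma bounded_positive1 : bounded_positive (@mx_one R N).
Proof. by exists 1 => //; exact: positive_bound1. Qed.

Lemma bounded_positive_mul A B : bounded_positive A -> bounded_positive B ->
  bounded_positive (mx_mul A B).
Proof.
move=> [a a0 Aa] [b b0 Bb]; exists (a * b); first exact: mulr_gt0.
by apply: positive_bound_mul => //; exact: ltW.
Qed.

Lemma bounded_positive_has_sum A B i k : bounded_positive A -> bounded_positive B ->
  has_sum (fun j => A i j * B j k) (mx_mul A B i k).
Proof. by move=> [a _ Aa] [b _ Bb]; exact: positive_bound_has_sum Aa Bb. Qed.

Arguments bounded_positive_has_sum {A B} i k Ab Bb : rename.

Lemma bounded_positive_mulA A B C : bounded_positive A -> bounded_positive B ->
  bounded_positive C -> mx_mul A (mx_mul B C) = mx_mul (mx_mul A B) C.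
Proof.
by move=> [a a0 Aa] [b b0 Bb] [c _ Cc]; apply: mx_mulA Aa Bb Cc => //; exact: ltW.
Qed.

Lemma mx_mul_le A A' B B' : bounded_positive A -> bounded_positive A' ->
  bounded_positive B -> bounded_positive B' -> mx_le A A' -> mx_le B B' ->
  mx_le (mx_mul A B) (mx_mul A' B').
Proof.
move=> Ab A'b Bb B'b AA' BB' i k.
apply: (ler_has_sum _ (bounded_positive_has_sum i k Ab Bb)
  (bounded_positive_has_sum i k A'b B'b)).
by move=> j; apply: ler_pM; rewrite ?(bounded_positive_ge0 Ab) ?(bounded_positive_ge0 Bb).
Qed.

Lemma bounded_positive_hadamard n a (C : 'I_n -> mx R N) :
  (0 < n)%N -> 1 <= n%:R * a -> (forall i, bounded_positive (C i)) ->
  bounded_positive (hadamard (fun i => hadamard_pow (C i) a)).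
Proof.
move=> n0 na Cb; have /choice[c Cc] : forall i, exists c, 0 < c /\ positive_bound L (C i) c.
  by move=> i; have [c ? ?] := Cb i; exists c.
exists (\prod_(i < n) c i `^ a).
  by apply: prodr_gt0 => i _; rewrite powR_gt0 // (Cc i).1.
by apply: positive_bound_hadamard => // i; case: (Cc i).
Qed.

Section Indexed.
Variables (I : Type).
Implicit Types (r s : seq I) (F G : I -> mx R N).

Lemma bounded_positive_prod r F : (forall l, bounded_positive (F l)) ->
  bounded_positive (mprod_(l <- r) F l).
Proof.
move=> Fb; elim: r => [|l r IH]; first by rewrite big_nil; exact: bounded_positive1.
by rewrite big_cons; exact: bounded_positive_mul.
Qed.

Lemma mx_prod_cat r s F : (forall l, bounded_positive (F l)) ->
  mprod_(l <- r ++ s) F l = mx_mul (mprod_(l <- r) F l) (mprod_(l <- s) F l).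
Proof.
move=> Fb; elim: r => [|l r IH]; first by rewrite big_nil mx_mul1m.
rewrite cat_cons !big_cons IH bounded_positive_mulA //; exact: bounded_positive_prod.
Qed.

Lemma mx_prod_le r F G : (forall l, bounded_positive (F l)) ->
  (forall l, bounded_positive (G l)) -> (forall l, mx_le (F l) (G l)) ->
  mx_le (mprod_(l <- r) F l) (mprod_(l <- r) G l).
Proof.
move=> Fb Gb FG; elim: r => [|l r IH]; first by rewrite !big_nil => i j.
by rewrite !big_cons; apply: mx_mul_le => //; exact: bounded_positive_prod.
Qed.

(** An entry of a product of two such Hadamard products is a sum of products of a-th powers, and
    Hoelder moves the summation inside the powers. Induction on the number of factors does the
    rest. *)
Lemma mx_prod_hadamard_le n a r (F : 'I_n -> I -> mx R N) :
  (0 < n)%N -> 1 <= n%:R * a -> (forall i l, bounded_positive (F i l)) ->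
  mx_le (mprod_(l <- r) hadamard (fun i => hadamard_pow (F i l) a))
        (hadamard (fun i => hadamard_pow (mprod_(l <- r) F i l) a)).
Proof.
move=> n0 na Fb; have Hb l := bounded_positive_hadamard n0 na (Fb ^~ l).
elim: r => [|l r IH] i k.
  rewrite big_nil /hadamard /hadamard_pow /mx_one.
  under eq_bigr do rewrite big_nil.
  have [_|_] := eqVneq i k; first by rewrite powR1 big1.
  by apply: prodr_ge0 => ? _; exact: powR_ge0.
have Pb i' : bounded_positive (mprod_(l <- r) F i' l) by apply: bounded_positive_prod.
have PHb := bounded_positive_hadamard n0 na Pb.
rewrite big_cons; apply: (@le_trans _ _ (mx_mul (hadamard (fun i => hadamard_pow (F i l) a))
    (hadamard (fun i => hadamard_pow (mprod_(l <- r) F i l) a)) i k)).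
  by apply: mx_mul_le => //; exact: bounded_positive_prod.
have [s Hs sle] := has_sum_holder n0 na
  (fun i' j => mulr_ge0 (bounded_positive_ge0 (Fb i' l) i j) (bounded_positive_ge0 (Pb i') j k))
  (fun i' => bounded_positive_has_sum i k (Fb i' l) (Pb i')).
have -> : mx_mul (hadamard (fun i => hadamard_pow (F i l) a))
    (hadamard (fun i => hadamard_pow (mprod_(l <- r) F i l) a)) i k = s.
  apply: has_sum_unique (bounded_positive_has_sum i k (Hb l) PHb) _.
  congr has_sum: Hs; apply/funext => j; rewrite /hadamard /hadamard_pow -big_split /=.
  by apply: eq_bigr => i' _; rewrite powRM ?(bounded_positive_ge0 (Fb _ _)) ?(bounded_positive_ge0 (Pb _)).
rewrite /hadamard /hadamard_pow (le_trans sle) // le_eqVlt; apply/orP; left; apply/eqP.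
by apply: eq_bigr => i' _; rewrite big_cons.
Qed.

End Indexed.

Definition mx_pow A k : mx R N := iter k (mx_mul A) (@mx_one R N).

Lemma mx_prod_const (I : Type) (r : seq I) A : mprod_(l <- r) A = mx_pow A (size r).
Proof. by rewrite big_const_seq count_predT. Qed.

Lemma mx_pow_iota A k : mx_pow A k = mprod_(l <- iota 0 k) A.
Proof. by rewrite mx_prod_const size_iota. Qed.

Lemma bounded_positive_pow A k : bounded_positive A -> bounded_positive (mx_pow A k).
Proof. by move=> Ab; rewrite mx_pow_iota; exact: bounded_positive_prod. Qed.

Lemma mx_pow_add A j k : bounded_positive A ->
  mx_pow A (j + k) = mx_mul (mx_pow A j) (mx_pow A k).
Proof.
move=> Ab; rewrite -{1}(size_iota 0 j) -{1}(size_iota 0 k) -size_cat.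
by rewrite -mx_prod_const mx_prod_cat // !mx_prod_const !size_iota.
Qed.

Lemma mx_pow_mul A j k : bounded_positive A -> mx_pow A (k * j) = mx_pow (mx_pow A j) k.
Proof. by move=> Ab; elim: k => [|k IH] //; rewrite mulSn mx_pow_add // IH. Qed.

Lemma mx_pow_swap A B k : bounded_positive A -> bounded_positive B ->
  mx_pow (mx_mul A B) k.+1 = mx_mul A (mx_mul (mx_pow (mx_mul B A) k) B).
Proof.
move=> Ab Bb; elim: k => [|k IH]; first by rewrite /mx_pow /= mx_mul1m mx_mulm1.
have P := bounded_positive_pow k (bounded_positive_mul Bb Ab).
rewrite {1}/mx_pow iterS -/(mx_pow _ k.+1) IH.
rewrite [mx_pow _ k.+1]/mx_pow iterS -/(mx_pow _ k).
have PB := bounded_positive_mul P Bb.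
rewrite -(bounded_positive_mulA Ab Bb (bounded_positive_mul Ab PB)).
by rewrite -(bounded_positive_mulA (bounded_positive_mul Bb Ab) P Bb)
  -(bounded_positive_mulA Bb Ab PB).
Qed.

Lemma mx_operator_iter A k x : bounded_positive A ->
  iter k (mx_operator L A) x = mx_operator L (mx_pow A k) x.
Proof.
move=> Ab; elim: k => [|k IH]; first by rewrite mx_operator1.
have [[a a0 Aa] [p p0 Pp]] := (Ab, bounded_positive_pow k Ab).
by rewrite iterS IH [in RHS]/mx_pow iterS (mx_operator_mul hL (ltW a0) Aa Pp).
Qed.

End MatrixProducts.

(** * Inequalities between spectral radii *)

Section SpectralRadius.
Variables (R : realType) (N : index_set) (L : banach_sequence_space R N).
Hypothesis hL : unit_normalized L.
Implicit Types (A B : mx R N) (a b mu : R).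

(** A substitute for Gelfand's formula: by [rho_le_growth] and [growth_above_rho], rho(A) is the
    infimum of the mu > 0 with this property. *)
Definition power_growth A mu :=
  exists2 C, 0 <= C & forall k, positive_bound L (mx_pow A k) (C * mu ^+ k).

Lemma rho_ge0 A : 0 <= rho L A.
Proof. exact: spectral_radius_ge0. Qed.

Lemma rho_le_growth A mu : bounded_positive L A -> 0 < mu -> power_growth A mu ->
  rho L A <= mu.
Proof.
move=> Ab mu0 [C C0 AC]; apply: spectral_radius_le (ltW mu0) _ => l mul.
have [a a0 Aa] := Ab.
apply: (neumann_resolvent (C := 4 * C) _ mu0 mul) => [b x y|k x].
  exact: (mx_operator_linear Aa).
rewrite (mx_operator_iter hL) // -[4 * C * _]mulrA; apply: (mx_operator_norm (AC k)).
by rewrite mulr_ge0 // exprn_ge0 // ltW.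
Qed.

(* With S the positive resolvent at mu, mu S x = x + A S x >= x and
   mu S x = x + S A x >= S A x give A^k x <= mu^(k+1) S x by induction. *)
Lemma growth_above_rho A mu : bounded_positive L A -> rho L A < mu -> power_growth A mu.
Proof.
move=> Ab rmu; have mu0 : 0 < mu by exact: le_lt_trans (rho_ge0 A) rmu.
have [a a0 Aa] := Ab; pose T := mx_operator L A.
have [S [Slin Sb SK KS] Spos] := positive_resolvent hL (ltW a0) Aa rmu.
have [K K1 SKb] := bounded_by_ge1 Sb.
have [_ SZ SD SB] := linear_laws Slin.
have dom k x : positive x -> positive (mu%:C ^+ k.+1 *: S x - iter k T x).
  elim: k x => [|k IH] x x0.
    rewrite expr1 /= -{2}(KS x) opprB addrC subrK.
    by apply: (mx_operator_positive Aa); exact: Spos.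
  have h := IH (T x) (mx_operator_positive Aa x0).
  have SE : mu%:C *: S x = S (T x) + x.
    by have /eqP := SK x; rewrite SB SZ subr_eq addrC => /eqP.
  rewrite iterSr exprSr -scalerA SE scalerDr addrAC; apply: positiveD => //.
  by rewrite -rmorphXn; apply: positiveZ => //; rewrite exprn_ge0 // ltW.
exists (mu * K) => [|k]; first by rewrite mulr_ge0 ?(ltW mu0) // (le_trans ler01).
have [p p0 Pp] := bounded_positive_pow hL k Ab; split; first exact: Pp.1.
move=> x f f0 xf; have x0 := represents_positive f0 xf.
have [g [Ag Tg _]] := mx_operator_represents Pp f0 xf.
exists (mx_operator L (mx_pow A k) x), g; split => //.
rewrite -(mx_operator_iter hL) //.
apply: le_trans (positive_norm_le _ (dom k x x0)) _.
  elim: k {p p0 Pp g Ag Tg} => [|k IH] //=; exact: (mx_operator_positive Aa).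
rewrite -rmorphXn real_normZr ger0_norm ?exprn_ge0 ?(ltW mu0) //.
apply: le_trans (ler_wpM2l _ (SKb x)) _; first by rewrite exprn_ge0 // ltW.
by rewrite exprS le_eqVlt; apply/orP; left; apply/eqP; ring.
Qed.

Lemma ler_above (x y : R) : (forall z, x < z -> y <= z) -> y <= x.
Proof. by move=> H; apply/ler_addgt0Pr => e e0; apply: H; rewrite ltrDl. Qed.

Lemma rho_mono A B : mx_nonneg A -> mx_le A B -> bounded_positive L B ->
  rho L A <= rho L B.
Proof.
move=> A0 AB Bb; apply: ler_above => mu rmu.
have mu0 : 0 < mu by exact: le_lt_trans (rho_ge0 B) rmu.
have Ab := bounded_positive_mono A0 AB Bb.
have [C C0 HC] := growth_above_rho Bb rmu.
apply: rho_le_growth => //; exists C => // k.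
apply: positive_bound_mono _ _ (lexx _) (HC k).
  exact: bounded_positive_ge0 (bounded_positive_pow hL k Ab).
by rewrite !mx_pow_iota; apply: (mx_prod_le hL).
Qed.

Lemma rho_mul_le A B : bounded_positive L A -> bounded_positive L B ->
  rho L (mx_mul A B) <= rho L (mx_mul B A).
Proof.
move=> Ab Bb; apply: ler_above => mu rmu.
have mu0 : 0 < mu by exact: le_lt_trans (rho_ge0 _) rmu.
have [C C0 HC] := growth_above_rho (bounded_positive_mul hL Bb Ab) rmu.
have ABb := bounded_positive_mul hL Ab Bb.
have [[a a0 Aa] [b b0 Bbd]] := (Ab, Bb).
have aCb : 0 <= a * C * b / mu by rewrite !mulr_ge0 ?invr_ge0 // ltW.
(* The 1 serves k = 0; for (AB)^(k+1) = A (BA)^k B the bound a C mu^k b equals (a C b / mu)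
   mu^(k+1). *)
apply: rho_le_growth => //; exists (1 + a * C * b / mu); first exact: addr_ge0.
case=> [|k].
  apply: positive_bound_weaken (positive_bound1 L).
  by rewrite expr0 mulr1 lerDl.
rewrite (mx_pow_swap hL) //.
have Ck : 0 <= C * mu ^+ k by rewrite mulr_ge0 // exprn_ge0 // ltW.
have := positive_bound_mul hL (ltW a0) Aa (positive_bound_mul hL Ck (HC k) Bbd).
apply: positive_bound_weaken.
rewrite mulrDl mul1r exprS; apply: (@le_trans _ _ (a * C * b / mu * (mu * mu ^+ k))).
  by rewrite le_eqVlt; apply/orP; left; apply/eqP; field; rewrite gt_eqF.
by rewrite lerDr mulr_ge0 ?exprn_ge0 ?(ltW mu0).
Qed.

Lemma rho_mulC A B : bounded_positive L A -> bounded_positive L B ->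
  rho L (mx_mul A B) = rho L (mx_mul B A).
Proof. by move=> Ab Bb; apply/eqP; rewrite eq_le !rho_mul_le. Qed.

Lemma rho_pow A m : (0 < m)%N -> bounded_positive L A ->
  rho L A ^+ m <= rho L (mx_pow A m).
Proof.
move=> m0 Ab; apply: ler_above => mu rmu.
have mu0 : 0 < mu by exact: le_lt_trans (rho_ge0 _) rmu.
have [C C0 HC] := growth_above_rho (bounded_positive_pow hL m Ab) rmu.
pose nu := mu `^ m%:R^-1; have nu0 : 0 < nu by exact: powR_gt0.
have numu : nu ^+ m = mu.
  by rewrite -powR_mulrn ?powR_ge0 // -powRrM mulVf ?powRr1 ?(ltW mu0) // pnatr_eq0 -lt0n.
have [a a0 Aa] := Ab.
suff : rho L A <= nu by rewrite -numu; apply: lerXn2r; rewrite nnegrE ?rho_ge0 ?ltW.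
have t0 s : 0 <= (a / nu) ^+ s by rewrite exprn_ge0 // divr_ge0 ?ltW.
(* Write A^k as a power of A^m times A^s with s = k mod m. The remainder contributes (a / nu)^s, and
   the sum over s < m majorises every case. *)
apply: rho_le_growth => //; exists (C * \sum_(s < m) (a / nu) ^+ s).
  by rewrite mulr_ge0 // sumr_ge0.
move=> k; rewrite {1}(divn_eq k m) (mx_pow_add hL) // (mx_pow_mul hL) //.
have Ak s : positive_bound L (mx_pow A s) (a ^+ s).
  elim: s => [|s IH]; first by rewrite expr0; exact: positive_bound1.
  by rewrite exprS; exact: positive_bound_mul (ltW a0) Aa IH.
have Cq : 0 <= C * mu ^+ (k %/ m) by rewrite mulr_ge0 // exprn_ge0 // ltW.
apply: positive_bound_weaken (positive_bound_mul hL Cq (HC _) (Ak (k %% m)%N)).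
have sm : (k %% m < m)%N by rewrite ltn_mod.
apply: (@le_trans _ _ (C * (a / nu) ^+ (k %% m) * nu ^+ k)).
  have -> : nu ^+ k = mu ^+ (k %/ m) * nu ^+ (k %% m).
    by rewrite {1}(divn_eq k m) exprD mulnC exprM numu.
  rewrite expr_div_n le_eqVlt; apply/orP; left; apply/eqP; field.
  by rewrite expf_neq0 // gt_eqF.
rewrite ler_pM2r ?exprn_gt0 // ler_wpM2l //.
by rewrite (bigD1 (Ordinal sm)) //= lerDl sumr_ge0.
Qed.

(** The k-th power of the Hadamard product is dominated by the Hadamard product of the matrices
    B_i^k raised to a, whose bound is a constant times (mu^(n a))^k. *)
Lemma rho_hadamard_pow n a (B : 'I_n -> mx R N) (r : R) :
  (0 < n)%N -> 1 <= n%:R * a -> (forall i, bounded_positive L (B i)) ->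
  (forall i, rho L (B i) <= r) ->
  rho L (hadamard (fun i => hadamard_pow (B i) a)) <= r `^ (n%:R * a).
Proof.
move=> n0 na Bb Br; set H := hadamard _; set e := n%:R * a.
have Hb : bounded_positive L H by exact: bounded_positive_hadamard.
have e0 : 0 < e by exact: lt_le_trans na.
have r0 : 0 <= r by apply: le_trans (Br (Ordinal n0)); exact: rho_ge0.
have eK x : 0 <= x -> (x `^ e^-1) `^ e = x.
  by move=> x0; rewrite -powRrM mulVf ?gt_eqF // powRr1.
(* Taking e-th roots first reduces the claim to a bound by each mu > r, so no limit of powers has to
   be taken. *)
rewrite -(eK _ (rho_ge0 H)); apply: ge0_ler_powR; rewrite ?nnegrE ?powR_ge0 ?(ltW e0) //.
apply: ler_above => mu rmu; have mu0 : 0 < mu by exact: le_lt_trans rmu.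
suff Hmu : rho L H <= mu `^ e.
  have -> : mu = (mu `^ e) `^ e^-1 by rewrite -powRrM divff ?gt_eqF // powRr1 // ltW.
  by apply: ge0_ler_powR; rewrite ?nnegrE ?powR_ge0 ?rho_ge0 ?invr_ge0 ?(ltW e0).
have /choice[C HC] : forall i, exists C, 0 < C /\
    forall k, positive_bound L (mx_pow (B i) k) (C * mu ^+ k).
  move=> i; have [C C0 HC] := growth_above_rho (Bb i) (le_lt_trans (Br i) rmu).
  exists (C + 1); split; first by rewrite ltr_wpDl.
  move=> k; apply: positive_bound_weaken (HC k).
  by rewrite ler_pM2r ?exprn_gt0 // lerDl.
apply: rho_le_growth => //; first exact: powR_gt0.
exists (\prod_(i < n) C i `^ a) => [|k].
  by apply: prodr_ge0 => i _; exact: powR_ge0.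
have Ck i : 0 < C i * mu ^+ k by rewrite mulr_gt0 ?(HC i).1 ?exprn_gt0.
have := positive_bound_hadamard hL n0 na Ck (fun i => (HC i).2 k).
have -> : \prod_(i < n) (C i * mu ^+ k) `^ a = \prod_(i < n) C i `^ a * (mu `^ e) ^+ k.
  under eq_bigr do rewrite powRM ?exprn_ge0 ?(ltW mu0) ?(ltW (HC _).1) //.
  rewrite big_split /= prodr_const card_ord; congr (_ * _).
  by rewrite -!powR_mulrn ?powR_ge0 ?(ltW mu0) // -!powRrM /e; congr (_ `^ _); ring.
apply: positive_bound_mono => //.
  exact: bounded_positive_ge0 (bounded_positive_pow hL k Hb).
have -> : (fun i => hadamard_pow (mx_pow (B i) k) a) =
    fun i => hadamard_pow (\big[@mx_mul R N/@mx_one R N]_(l <- iota 0 k) B i) a.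
  by apply/funext => i; rewrite mx_pow_iota.
by rewrite mx_pow_iota; exact: (mx_prod_hadamard_le hL).
Qed.

End SpectralRadius.

(** * Cyclic products and the chain of inequalities *)

Section CyclicProducts.
Variables (R : realType) (N : index_set) (L : banach_sequence_space R N).
Hypothesis hL : unit_normalized L.

(** With a single factor the condition n a >= 1 reads a >= 1, so the general lemmas cover the
    exponent t. *)
Lemma hadamard_pow1 (B : mx R N) (a : R) :
  hadamard_pow B a = hadamard (fun=> hadamard_pow B a : mx R N) (m := 1).
Proof. by apply/funext => i; apply/funext => j; rewrite /hadamard big_ord1. Qed.

Lemma bounded_positive_hadamard_pow (B : mx R N) (a : R) : 1 <= a ->
  bounded_positive L B -> bounded_positive L (hadamard_pow B a).
Proof.
by move=> a1 Bb; rewrite hadamard_pow1; apply: bounded_positive_hadamard; rewrite ?mul1r.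
Qed.

Lemma rho_hadamard_pow1 (B : mx R N) (a : R) : 1 <= a -> bounded_positive L B ->
  rho L (hadamard_pow B a) <= rho L B `^ a.
Proof.
move=> a1 Bb; rewrite hadamard_pow1.
by have := @rho_hadamard_pow _ _ _ hL 1 a (fun=> B) (rho L B); rewrite mul1r; apply.
Qed.

Lemma mx_prod_hadamard_pow_le (I : Type) (s : seq I) (F : I -> mx R N) (a : R) :
  1 <= a -> (forall l, bounded_positive L (F l)) ->
  mx_le (\big[@mx_mul R N/@mx_one R N]_(l <- s) hadamard_pow (F l) a)
        (hadamard_pow (\big[@mx_mul R N/@mx_one R N]_(l <- s) F l) a).
Proof.
move=> a1 Fb; rewrite [X in mx_le _ X]hadamard_pow1.
under eq_bigr do rewrite hadamard_pow1.
by apply: (mx_prod_hadamard_le hL) => //; rewrite mul1r.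
Qed.

Lemma mx_prod_enum m (F : 'I_m -> mx R N) :
  mx_prod F = \big[@mx_mul R N/@mx_one R N]_(k <- enum 'I_m) F k.
Proof. by rewrite /mx_prod [index_enum _]unlock -enumT. Qed.

Lemma rho_mx_cyclic_prod m (F : 'I_m -> mx R N) i :
  (forall k, bounded_positive L (F k)) ->
  rho L (mx_cyclic_prod F i) = rho L (mx_prod F).
Proof.
move=> Fb; rewrite mx_prod_enum /mx_cyclic_prod /rot (mx_prod_cat hL) //.
rewrite (rho_mulC hL); [|exact: bounded_positive_prod..].
by rewrite -(mx_prod_cat hL) // cat_take_drop.
Qed.

End CyclicProducts.

(** Counting from 0, this is the index of factor l of P_i. For fixed l it permutes the indices, so
    the l-th factors of all the P_i together are A_1, ..., A_m up to order. *)
Definition ord_shift m (l : nat) (i : 'I_m) : 'I_m :=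
  Ordinal (ltn_pmod (i + l) (leq_ltn_trans (leq0n i) (ltn_ord i))).

Lemma ord_shift_inj m l : injective (@ord_shift m l).
Proof.
move=> i j /(congr1 val)/eqP /=; rewrite eqn_modDr !modn_small // => /eqP.
exact: val_inj.
Qed.

Lemma rot_enum_ord m (i : 'I_m) :
  rot i (enum 'I_m) = [seq ord_shift l i | l <- iota 0 m].
Proof.
apply: (inj_map val_inj); rewrite map_rot val_enum_ord -map_comp.
have im : (i <= m)%N by exact: ltnW.
have iota_m : iota 0 m = iota 0 (m - i) ++ [seq (m - i + l)%N | l <- iota 0 i].
  by rewrite -{1}(subnK im) iotaD -iotaDl addn0.
have -> : rot i (iota 0 m) = [seq (i + l)%N | l <- iota 0 (m - i)] ++ iota 0 i.
  by rewrite /rot drop_iota take_iota (minn_idPl im) add0n -iotaDl addn0.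
rewrite [in RHS]iota_m map_cat -map_comp.
congr (_ ++ _).
  apply/eq_in_map => l; rewrite mem_iota add0n /= => lm.
  by rewrite modn_small // -ltn_subRL.
rewrite -[LHS]map_id; apply/eq_in_map => l; rewrite mem_iota add0n /= => li.
by rewrite addnA subnKC // modnDl modn_small // (ltn_trans li).
Qed.

(** The arithmetic of the exponents, where r, q, p, h and b stand for the five spectral radii in
    their order of appearance. *)
Lemma powR_chain (R : realType) (m : nat) (t r q p h b : R) :
  (0 < m)%N -> 1 <= t -> t <= m%:R ->
  0 <= r -> 0 <= q -> 0 <= p -> 0 <= h -> 0 <= b ->
  r ^+ m <= q -> q <= p `^ (m%:R * t^-1) -> p <= h -> h <= b `^ t ->
  [/\ r <= r `^ (1 - t / m%:R) * q `^ (t / m%:R ^+ 2),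
      r `^ (1 - t / m%:R) * q `^ (t / m%:R ^+ 2)
        <= r `^ (1 - t / m%:R) * p `^ m%:R^-1,
      r `^ (1 - t / m%:R) * p `^ m%:R^-1 <= r `^ (1 - t / m%:R) * h `^ m%:R^-1 &
      r `^ (1 - t / m%:R) * h `^ m%:R^-1 <= b].
Proof.
move=> m0 t1 tm r0 q0 p0 h0 b0 rq qp ph hb.
have mR : 0 < m%:R :> R by rewrite ltr0n.
have t0 : 0 < t by exact: lt_le_trans t1.
have [mn0 tn0] : m%:R != 0 :> R /\ t != 0 by rewrite !gt_eqF.
have mono (x y a : R) : 0 <= a -> 0 <= x -> x <= y -> x `^ a <= y `^ a.
  by move=> a0 x0 xy; apply: ge0_ler_powR; rewrite ?nnegrE // (le_trans x0).
(* This holds at x = 0 too, because the exponents add up to 1, which is non-zero. *)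
have splitE (x : R) : 0 <= x -> x = x `^ (1 - t / m%:R) * x `^ (t / m%:R).
  by move=> x0; rewrite -powRD ?subrK ?powRr1 // oner_eq0.
have e1 : 0 <= 1 - t / m%:R by rewrite subr_ge0 ler_pdivrMr // mul1r.
have e2 : 0 <= t / m%:R ^+ 2 by rewrite divr_ge0 ?exprn_ge0 ?ltW.
have e3 : 0 <= m%:R^-1 :> R by rewrite invr_ge0 ltW.
have e4 : 0 <= m%:R * t^-1 by rewrite divr_ge0 ?ltW.
(* The hypotheses chain to r^m <= q <= p^(m/t) <= (b^t)^(m/t) = b^m; the last link needs r <= b for
   its first factor. *)
have rb : r <= b.
  suff : r ^+ m <= b ^+ m by rewrite ler_pXn2r ?nnegrE.
  have -> : b ^+ m = (b `^ t) `^ (m%:R * t^-1).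
    by rewrite -powRrM -powR_mulrn //; congr (_ `^ _); field.
  by apply: le_trans rq (le_trans qp _); apply: mono => //; exact: le_trans hb.
split.
- rewrite {1}(splitE r) // ler_wpM2l ?powR_ge0 //.
  have -> : r `^ (t / m%:R) = (r ^+ m) `^ (t / m%:R ^+ 2).
    by rewrite -powR_mulrn // -powRrM; congr (_ `^ _); field.
  by apply: mono; rewrite ?exprn_ge0.
- rewrite ler_wpM2l ?powR_ge0 //.
  have -> : p `^ m%:R^-1 = (p `^ (m%:R * t^-1)) `^ (t / m%:R ^+ 2).
    by rewrite -powRrM; congr (_ `^ _); field; rewrite mn0 tn0.
  exact: mono.
- by rewrite ler_wpM2l ?powR_ge0 //; exact: mono.
- rewrite [leRHS]splitE // ler_pM ?powR_ge0 //; first exact: mono.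
  by rewrite powRrM; exact: mono.
Qed.

Theorem corollary3p4 (R : realType) (N : index_set)
    (L : banach_sequence_space R N) (hL : unit_normalized L)
    (m : nat) (hm : (2 <= m)%N) (A : 'I_m -> mx R N)
    (hA0 : forall i, mx_nonneg (A i)) (hA : forall i, defines_operator L (A i))
    (t : R) (ht1 : 1 <= t) (htm : t <= m%:R) :
  let At := fun k => hadamard_pow (A k) t in
  let P := fun i => mx_cyclic_prod At i in
  let r := rho L (hadamard A) in
  [/\ r <= r `^ (1 - t / m%:R)
           * rho L (hadamard (fun i => hadamard_pow (P i) t^-1))
             `^ (t / m%:R ^+ 2),
      r `^ (1 - t / m%:R)
        * rho L (hadamard (fun i => hadamard_pow (P i) t^-1))
          `^ (t / m%:R ^+ 2)
        <= r `^ (1 - t / m%:R) * rho L (mx_prod At) `^ m%:R^-1,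
      r `^ (1 - t / m%:R) * rho L (mx_prod At) `^ m%:R^-1
        <= r `^ (1 - t / m%:R)
           * rho L (hadamard_pow (mx_prod A) t) `^ m%:R^-1 &
      r `^ (1 - t / m%:R)
        * rho L (hadamard_pow (mx_prod A) t) `^ m%:R^-1
        <= rho L (mx_prod A)].
Proof.
move=> At P r; have m0 : (0 < m)%N by exact: ltnW.
have mR : 0 < m%:R :> R by rewrite ltr0n.
have t0 : 0 < t by exact: lt_le_trans ht1.
(* This is the condition n a >= 1 for m factors with exponent 1/t. *)
have mt : 1 <= m%:R * t^-1 by rewrite ler_pdivlMr // mul1r.
have Ab i : bounded_positive L (A i) by exact: defines_bounded_positive.
have Atb i : bounded_positive L (At i) by exact: bounded_positive_hadamard_pow.
have Pb i : bounded_positive L (P i) by exact: bounded_positive_prod.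
have AtK k : hadamard_pow (At k) t^-1 = A k.
  apply/funext => i; apply/funext => j.
  by rewrite /hadamard_pow -powRrM divff ?gt_eqF // powRr1 // hA0.
(* Each A_k is the (1/t)-th Hadamard power of A_k^(t), so the Hadamard bound applies to the product
   of the A_k. *)
have Hb : bounded_positive L (hadamard A).
  have := bounded_positive_hadamard hL m0 mt Atb.
  by under eq_fun do rewrite AtK.
have Bb : bounded_positive L (mx_prod A) by exact: bounded_positive_prod.
set Q := hadamard (fun i => hadamard_pow (P i) t^-1).
have Qb : bounded_positive L Q by exact: bounded_positive_hadamard.
have HQ : mx_le (mx_pow (hadamard A) m) Q.
  have := mx_prod_hadamard_le hL (iota 0 m) m0 mt (fun i l => Atb (ord_shift l i)).
  have -> : (fun i => hadamard_pow (\big[@mx_mul R N/@mx_one R N]_(l <- iota 0 m)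
      At (ord_shift l i)) t^-1) = fun i => hadamard_pow (P i) t^-1.
    by apply/funext => i; rewrite /P /mx_cyclic_prod rot_enum_ord big_map.
  rewrite mx_pow_iota; congr mx_le; apply: eq_bigr => l _.
  apply/funext => i; apply/funext => j; rewrite /hadamard.
  under eq_bigr do rewrite AtK.
  by rewrite [RHS](reindex_inj (@ord_shift_inj m l)).
have rQ : r ^+ m <= rho L Q.
  apply: le_trans (rho_pow hL m0 Hb) _; apply: (rho_mono hL) => //.
  exact: bounded_positive_ge0 (bounded_positive_pow hL m Hb).
have QAt : rho L Q <= rho L (mx_prod At) `^ (m%:R * t^-1).
  by apply: (rho_hadamard_pow hL) => // i; rewrite (rho_mx_cyclic_prod hL).
have AtB : rho L (mx_prod At) <= rho L (hadamard_pow (mx_prod A) t).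
  apply: (rho_mono hL); first exact: bounded_positive_ge0 (bounded_positive_prod hL _ Atb).
    exact: (mx_prod_hadamard_pow_le hL).
  exact: bounded_positive_hadamard_pow.
have Bt := rho_hadamard_pow1 hL ht1 Bb.
by apply: (powR_chain m0 ht1 htm _ _ _ _ _ rQ QAt AtB Bt); exact: rho_ge0.
Qed.
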